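(* Let $\Phi_1,\Phi_2$ be two point processes with respective factorial moment measures $\alpha_i^{(k)}$, $i=1,2$, and let $W$ be a bounded Borel set in $\mathbb{R}^d$. Consider a family $\mathsf{K}$ of U-statistics. Then the following statements are true. 1. If $\alpha_1^{(j)}(\cdot)\le\alpha_2^{(j)}(\cdot)$ for all $1\le j\le k$, then $$\mathbf{E}\bigl(F_1(\Phi_1\cap W)F_2(\Phi_1\cap W)\cdots F_k(\Phi_1\cap W)\bigr)\le \mathbf{E}\bigl(F_1(\Phi_2\cap W)F_2(\Phi_2\cap W)\cdots F_k(\Phi_2\cap W)\bigr)$$ for any $k$-tuple of U-statistics $F_1,\ldots,F_k\in\mathsf{K}$. In particular, for any given $F\in\mathsf{K}$ based on a non-negative symmetric function $f$, it holds that $\alpha^{(k)}_{\eta_{(f,\Phi_1)}}(\cdot)\le\alpha^{(k)}_{\eta_{(f,\Phi_2)}}(\cdot)$, where $\alpha^{(k)}_{\eta_{(f,\Phi_i)}}$ is the $k$-th order factorial moment measure of $\eta_{(f,\Phi_i)}$. 2. If $\Phi_1\le_{\mathrm{dcx}}\Phi_2$, then $\{F(\Phi_1\cap W)\}_{F\in\mathsf{K}}\le_{\mathrm{idcx}}\{F(\Phi_2\cap W)\}_{F\in\mathsf{K}}$ and, in particular, $\eta_{(f,\Phi_1)}\le_{\mathrm{idcx}}\eta_{(f,\Phi_2)}$.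
   Context: Point processes are locally finite random counting measures on $\mathbb{R}^d$, $d\ge1$, with locally finite intensity measure. For a point process $\Phi$ on $\mathbb{R}^d$ and $k\ge 1$, $$\Phi^{(k)}(\mathrm{d}(x_1,\ldots,x_k))=\Phi(\mathrm{d}x_1)\,(\Phi\setminus\delta_{x_1})(\mathrm{d}x_2)\cdots\Bigl(\Phi\setminus\sum_{i=1}^{k-1}\delta_{x_i}\Bigr)(\mathrm{d}x_k)$$ is the (empirical) $k$-th order factorial moment measure of $\Phi$, a point process on $\mathbb{R}^{dk}$ (for simple $\Phi$ it is the point process of ordered $k$-tuples of distinct points of $\Phi$). Its mean measure $\alpha^{(k)}$ is the $k$-th order factorial moment measure of $\Phi$. An inequality $\alpha_1^{(j)}(\cdot)\le\alpha_2^{(j)}(\cdot)$ means inequality on all Borel sets. A U-statistic of a point process $\Phi$ is a functional $F(\Phi)=\sum_{X\in\Phi^{(k)}}f(X)$ for a non-negative symmetric function $f$ on $(\mathbb{R}^d)^k$; $F$ is said to be based on $f$. $\Phi\cap W$ denotes the restriction of $\Phi$ to $W$. For such $f$, $\eta_{(f,\Phi)}=\{f(X):X\in\Phi^{(k)}\}$ is the associated point process on $\mathbb{R}_+$, i.e. $\eta_{(f,\Phi)}(B)=\sum_{X\in\Phi^{(k)}}\mathbf{1}(f(X)\in B)$ for bounded Borel $B\subset\mathbb{R}_+$. It is always assumed that $f$ satisfies $|f^{-1}([0,x])|<\infty$ for all $x\in\mathbb{R}_+$, a condition given to ensure that $\eta_{(f,\Phi)}$ is locally finite and hence a point process. A Borel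 function $g:\mathbb{R}^n\to\mathbb{R}$ is directionally convex (dcx) if for all $x\in\mathbb{R}^n$, $\epsilon,\delta>0$ and $i,j\in\{1,\ldots,n\}$, $\Delta^i_\epsilon\Delta^j_\delta g(x)\ge0$, where $\Delta^i_\epsilon g(x)=g(x+\epsilon e_i)-g(x)$ and $e_1,\ldots,e_n$ are the canonical basis vectors. It is idcx if it is increasing and dcx. For random vectors of equal dimension, $X\le_{\mathrm{dcx}}Y$ (resp. $X\le_{\mathrm{idcx}}Y$) if $\mathbf{E}g(X)\le\mathbf{E}g(Y)$ for all dcx (resp. idcx) $g$ for which both expectations are finite. Random fields are ordered if all their finite-dimensional marginals are. Point processes satisfy $\Phi_1\le_{\mathrm{dcx}}\Phi_2$ (resp. $\le_{\mathrm{idcx}}$) if $(\Phi_1(B_1),\ldots,\Phi_1(B_n))\le_{\mathrm{dcx}}(\Phi_2(B_1),\ldots,\Phi_2(B_n))$ (resp. $\le_{\mathrm{idcx}}$) for all $n\ge 1$ and all bounded Borel sets $B_1,\ldots,B_n$.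
   Formalization: In 1, j runs up to the total order of the U-statistics (k times the order of f for η), not just k; in 2, idcx test functions must stay integrable for majorants of the kernels that are countable sums of indicators of rectangles, and η is assumed a.s. locally finite. As worded, both parts fail. *)

(* Defs.v *)
From HB Require Import structures.
From mathcomp Require Import all_boot all_order all_algebra perm.
From mathcomp Require Import all_classical all_reals all_analysis.
From mathcomp Require Import measurable_realfun.

Set Implicit Arguments.
Unset Strict Implicit.
Unset Printing Implicit Defensive.

Import Order.TTheory GRing.Theory Num.Theory.
Import numFieldNormedType.Exports.

Local Open Scope classical_set_scope.
Local Open Scope ring_scope.
Local Open Scope ereal_scope.

(* R^d is [d.-tuple R]: its measurable structure is generated by the
   coordinates, hence it is the Borel sigma-algebra. Likewise (R^d)^k is
   [k.-tuple (d.-tuple R)]. *)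

Definition tbounded (R : realType) (d : nat) (B : set (d.-tuple R)) : Prop :=
  exists M : R, forall x, B x -> forall i : 'I_d, (`|tnth x i| <= M)%R.

Definition bounded_borel (R : realType) (d : nat) (B : set (d.-tuple R)) : Prop :=
  measurable B /\ tbounded B.

Definition bounded_borel_nneg (R : realType) (B : set R) : Prop :=
  measurable B /\ exists M : R, B `<=` `[0%R, M].

Section point_processes.
Context (R : realType) (d : nat) (dO : measure_display)
  (Om : measurableType dO).

Record pointProcess (P : probability Om R) := PointProcess {
  pp_measure :> Om -> {measure set (d.-tuple R) -> \bar R} ;
  pp_measurable : forall B, measurable B ->
    measurable_fun [set: Om] (fun w => pp_measure w B) ;
  pp_count : forall w B, bounded_borel B ->
    exists n : nat, pp_measure w B = n%:R%:E ;
  pp_intensity : forall B, bounded_borel B ->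
    \int[P]_w pp_measure w B < +oo
}.

End point_processes.

(* [factorial_measure k mu] is mu^(k), by recursion on
     mu^(k+1)(d(x, y)) = mu(dx) (mu \ delta_x)^(k)(dy).
   It is stated for bare set functions because mu \ delta_x is a measure only
   when x is an atom of mu; the other x form a mu-null set when mu is a
   counting measure. *)
Fixpoint factorial_measure (R : realType) (dT : measure_display)
    (T : measurableType dT) (k : nat) (mu : set T -> \bar R) :
    set (k.-tuple T) -> \bar R :=
  match k with
  | 0 => fun A => \d_([tuple] : 0.-tuple T) A
  | k'.+1 => fun A =>
      \int[mu]_x @factorial_measure R dT T k' (fun B => mu B - \d_x B)
                   [set y : k'.-tuple T | A [tuple of x :: y]]
  end.

Definition factorial_moment (R : realType) (dO : measure_display)
    (Om : measurableType dO) (P : probability Om R)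
    (dT : measure_display) (T : measurableType dT)
    (Phi : Om -> set T -> \bar R) (k : nat) (A : set (k.-tuple T)) : \bar R :=
  \int[P]_w factorial_measure (Phi w) A.

Definition ustat (R : realType) (dT : measure_display) (T : measurableType dT)
    (m : nat) (f : m.-tuple T -> R) (mu : set T -> \bar R) : \bar R :=
  \int[factorial_measure (k := m) mu]_X (f X)%:E.

(* A U-statistic is given by the order m >= 1 and the function f it is based
   on. *)
Record ukernel (R : realType) (d : nat) := UKernel {
  uorder : nat ;
  ufun :> uorder.-tuple (d.-tuple R) -> R ;
  uorder_gt0 : (0 < uorder)%N ;
  ufun_measurable : measurable_fun [set: uorder.-tuple (d.-tuple R)] ufun ;
  ufun_ge0 : forall X, (0 <= ufun X)%R ;
  ufun_sym : forall (s : {perm 'I_uorder}) X,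
    ufun [tuple tnth X (s i) | i < uorder] = ufun X
}.

Arguments ufun {R d} u X.

Definition eta_pp (R : realType) (d m : nat) (f : m.-tuple (d.-tuple R) -> R)
    (mu : set (d.-tuple R) -> \bar R) (B : set R) : \bar R :=
  ustat (fun X => \1_B (f X)) mu.

(* Lebesgue (outer) measure on (R^d)^m, through countable covers by boxes. *)
Definition lebesgue_outer (R : realType) (d m : nat)
    (A : set (m.-tuple (d.-tuple R))) : \bar R :=
  ereal_inf [set v | exists a b : nat -> 'I_m -> 'I_d -> R,
    [/\ forall l i j, (a l i j <= b l i j)%R,
        A `<=` \bigcup_l [set X | forall i j,
                 (a l i j <= tnth (tnth X i) j <= b l i j)%R]
      & v = \sum_(l <oo) (\prod_(i < m) \prod_(j < d)
                            (b l i j - a l i j)%R)%R%:E] ].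

Definition finite_sublevels (R : realType) (d m : nat)
    (f : m.-tuple (d.-tuple R) -> R) : Prop :=
  forall x : R, (0 <= x)%R -> lebesgue_outer [set X | (f X <= x)%R] < +oo.

Section dcx.
Context (R : realType) (n : nat).
Implicit Types (x y : n.-tuple R) (g : n.-tuple R -> R).
Local Open Scope ring_scope.

Definition shift_coord (i : 'I_n) (e : R) x : n.-tuple R :=
  [tuple tnth x j + (if j == i then e else 0) | j < n].

Definition diff_op (i : 'I_n) (e : R) g : n.-tuple R -> R :=
  fun x => g (shift_coord i e x) - g x.

Definition dcx g : Prop :=
  measurable_fun [set: n.-tuple R] g /\
  forall x (e dl : R) (i j : 'I_n), 0 < e -> 0 < dl ->
    0 <= diff_op i e (diff_op j dl g) x.

Definition increasing g : Prop :=
  forall x y, (forall i, tnth x i <= tnth y i) -> g x <= g y.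

Definition idcx g : Prop := increasing g /\ dcx g.

End dcx.

Section orders.
Context (R : realType) (d1 d2 : measure_display)
  (Om1 : measurableType d1) (Om2 : measurableType d2)
  (P1 : probability Om1 R) (P2 : probability Om2 R).

(* The integral order generated by a class C of functions: <=dcx and <=idcx
   are [le_for (@dcx R n)] and [le_for (@idcx R n)]. *)
Definition le_for (n : nat) (C : set (n.-tuple R -> R))
    (X : Om1 -> n.-tuple R) (Y : Om2 -> n.-tuple R) : Prop :=
  forall g, C g ->
    P1.-integrable [set: Om1] (fun w => (g (X w))%:E) ->
    P2.-integrable [set: Om2] (fun w => (g (Y w))%:E) ->
    'E_P1[fun w => g (X w)] <= 'E_P2[fun w => g (Y w)].

Definition counts (d n : nat) (B : 'I_n -> set (d.-tuple R))
    (mu : set (d.-tuple R) -> \bar R) : n.-tuple R :=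
  [tuple fine (mu (B i)) | i < n].

Definition dcx_pp (d : nat) (Phi1 : pointProcess d P1)
    (Phi2 : pointProcess d P2) : Prop :=
  forall (n : nat) (B : 'I_n -> set (d.-tuple R)), (0 < n)%N ->
    (forall i, bounded_borel (B i)) ->
    le_for (@dcx R n) (fun w => counts B (Phi1 w)) (fun w => counts B (Phi2 w)).

Definition ustats (d n : nat) (m : 'I_n -> nat)
    (f : forall j, (m j).-tuple (d.-tuple R) -> R)
    (mu : set (d.-tuple R) -> \bar R) : n.-tuple R :=
  [tuple fine (ustat (f j) mu) | j < n].

Definition eta_counts (d m n : nat) (f : m.-tuple (d.-tuple R) -> R)
    (B : 'I_n -> set R) (mu : set (d.-tuple R) -> \bar R) : n.-tuple R :=
  [tuple fine (eta_pp f mu (B j)) | j < n].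

(* Countable non-negative combinations of indicators of measurable rectangles.
   They include every non-negative lower semicontinuous function and, for
   m = 1, every non-negative Borel function. *)
Definition rect_sum (d m : nat) (h : m.-tuple (d.-tuple R) -> R) : Prop :=
  exists (c : nat -> R) (B : nat -> 'I_m -> set (d.-tuple R)),
    [/\ forall l, (0 <= c l)%R,
        forall l i, measurable (B l i)
      & forall X, (h X)%:E =
          \sum_(l <oo) (c l * \prod_(i < m) \1_(B l i) (tnth X i))%R%:E].

(* "Both expectations are finite" does not suffice for U-statistics of order
   at least 2: counts in Borel sets only reach (R^d)^m through rectangles, and
   the f j may be such that g is not integrable on any rectangle-built
   neighbourhood of them. The expectations are therefore asked to remain
   finite for some majorants of the f j on W that are rectangle sums; when the
   f j are rectangle sums themselves, h := f gives back the usual condition. *)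
Definition rect_integrable (d n : nat) (m : 'I_n -> nat)
    (f : forall j, (m j).-tuple (d.-tuple R) -> R)
    (W : set (d.-tuple R)) (mW : measurable W)
    (Phi1 : pointProcess d P1) (Phi2 : pointProcess d P2)
    (g : n.-tuple R -> R) : Prop :=
  exists h : forall j, (m j).-tuple (d.-tuple R) -> R,
    [/\ forall j, rect_sum (h j),
        forall j X, (forall i, W (tnth X i)) -> (f j X <= h j X)%R,
        P1.-integrable [set: Om1]
          (fun w => (g (ustats h (mrestr (Phi1 w) mW)))%:E)
      & P2.-integrable [set: Om2]
          (fun w => (g (ustats h (mrestr (Phi2 w) mW)))%:E)].

End orders.

Definition locally_finite_nneg (R : realType) (mu : set R -> \bar R) : Prop :=
  forall M : R, mu [set` `[0%R, M]] < +oo.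

(* Main.v *)
(* Realization-wise, a point process is a sum of Dirac masses at points x_i, and
   its k-th factorial measure is the sum of the Dirac masses at the k-tuples of
   points with distinct indices.

   Part 1. A product of U-statistics is a sum over families of index tuples.
   Sorting the families by the pattern of coincidences between their indices
   writes it as a finite sum of integrals against factorial measures of orders
   between 1 and the total order, and the expectation of each of these integrals
   is monotone in the factorial moment measure. The factorial powers of eta are
   sums of the same kind.

   Part 2. If the kernels depend only on the classes of the points in a finite
   partition of W, the U-statistics are increasing directionally convex functions
   of the counts of the classes, so composing them with an idcx function gives a
   dcx function of the counts. A general kernel is approximated by such grid
   kernels so well that, by Borel-Cantelli, almost surely the approximation
   converges at all the tuples of points in W; idcx functions are continuous, and
   dominated convergence concludes. For eta one lets W increase to R^d. *)

Require Import Defs.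
From HB Require Import structures.
From mathcomp Require Import all_boot all_order all_algebra.
From mathcomp Require Import finmap.
From mathcomp Require Import all_classical all_reals all_analysis.
From mathcomp Require Import measurable_realfun.
From mathcomp Require Import zify ring lra.

Set Implicit Arguments.
Unset Strict Implicit.
Unset Printing Implicit Defensive.

Import Order.TTheory GRing.Theory Num.Theory.
Import numFieldNormedType.Exports.

Local Open Scope classical_set_scope.
Local Open Scope ring_scope.
Local Open Scope ereal_scope.

(** * Integration against sums of Dirac masses *)

(** Factorial measures are iterated integrals against set functions that are measures only when an
    atom is removed. Integrals are therefore evaluated for bare set functions that agree with a
    Dirac sum on measurable sets; these sums are also packaged as genuine measures, to which the
    usual theorems apply. Distinctness always refers to indices, never to points, so multiple points
    need no separate treatment. In Part 1 the moments are compared up to the total order, because a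
    family of index tuples without coincidences involves that many distinct indices. In Part 2 two
    things obstruct the passage from grid kernels to general ones. With no sigma-finite reference
    measure at hand, the error of an approximation is measured by the probability that some tuple of
    points of the process falls where it is wrong. Moreover the approximations must be dominated by
    something integrable: they are clamped between 0 and the partial sums of a rectangle-sum
    majorant, which are grid functions themselves, and the monotonicity of the idcx function turns
    this into a domination of the integrands. *)

Lemma esum_ge1 (R : realType) (I : choiceType) (D : set I) (a : I -> \bar R) i :
  D i -> 0 <= a i -> a i <= \esum_(i in D) a i.
Proof.
move=> Di ai; apply: esum_ge; exists [set i]; last by rewrite fsbig_set1.
by split; [exact: finite_set1|move=> _ ->].
Qed.

Lemma mule_esumr (R : realType) (I : choiceType) (D : set I) (a : I -> \bar R)
    (c : \bar R) : 0 <= c -> (forall i, D i -> 0 <= a i) ->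
  c * (\esum_(i in D) a i) = \esum_(i in D) (c * a i).
Proof.
move=> c0 a0; case: c c0 => [r| |]//= r0.
- rewrite /esum -ereal_supZl//; last first.
    by apply/set0P; exists 0; exists set0; [exact: fsets_set0|rewrite fsbig_set0].
  congr ereal_sup; apply/seteqP; split => [_ [_ [X XD <-] <-]|_ [X XD <-]]/=.
    exists X => //; rewrite !fsbig_finite//=; [|by case: XD..].
    rewrite big_seq [in RHS]big_seq ge0_sume_distrr// => i.
    by case: XD => finX XD; rewrite in_fset_set// inE => /XD/a0.
  exists (\sum_(i \in X) a i); first by exists X.
  rewrite !fsbig_finite//=; [|by case: XD..].
  rewrite big_seq [in RHS]big_seq ge0_sume_distrr// => i.
  by case: XD => finX XD; rewrite in_fset_set// inE => /XD/a0.
(* For [c = +oo] both sides are [+oo] as soon as one term is non-zero; otherwise both vanish,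
   because [+oo * 0 = 0]. *)
- have [[i [Di ai]]|h] := pselect (exists i, D i /\ a i != 0).
    have ai0 : 0 < a i by rewrite lt_neqAle eq_sym ai a0.
    rewrite gt0_mulye; last by apply: lt_le_trans (esum_ge1 Di (a0 _ Di)).
    apply/esym/eqP; rewrite -leye_eq.
    apply: le_trans (_ : +oo * a i <= _); first by rewrite gt0_mulye.
    by apply: (@esum_ge1 _ _ D (fun i => +oo * a i) i) => //; rewrite mule_ge0// a0.
  have a00 i : D i -> a i = 0.
    by move=> Di; apply/eqP/negPn/negP => ai; apply: h; exists i.
  by rewrite !esum1 ?mule0// => i /a00 ->; rewrite mule0.
Qed.

Lemma mule_esuml (R : realType) (I : choiceType) (D : set I) (a : I -> \bar R)
    (c : \bar R) : 0 <= c -> (forall i, D i -> 0 <= a i) ->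
  (\esum_(i in D) a i) * c = \esum_(i in D) (a i * c).
Proof.
by move=> c0 a0; rewrite muleC mule_esumr//; apply: eq_esum => i _; rewrite muleC.
Qed.

(* The value of f off the atoms is irrelevant, so that f need be neither
   measurable nor non-negative there. *)
Section integral_dirac_sum.
Context (R : realType) dT (T : measurableType dT) (I : choiceType).
Context (D : set I) (x : I -> T) (mu : set T -> \bar R).
Hypothesis mset1 : forall t : T, measurable [set t].
Hypothesis muE : forall A, measurable A -> mu A = \esum_(i in D) \d_(x i) A.

Import HBNNSimple.

Lemma sintegral_dirac_sum (h : {nnsfun T >-> R}) :
  sintegral mu h = \esum_(i in D) (h (x i))%:E.
Proof.
rewrite /sintegral -(fsbig_widen (range h))//=; last first.
  move=> r [_ rh] /=; rewrite muE//.
  rewrite esum1 ?mule0// => i Di; rewrite diracE memNset//= => hr.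
  by apply: rh; exists (x i).
rewrite fsbig_finite//=; under eq_bigr => r _.
  rewrite muE//.
  over.
rewrite big_seq; under eq_bigr => r rh.
  rewrite mule_esumr//; last first.
    by move: rh; rewrite in_fset_set// inE => -[t _ <-]; rewrite lee_fin.
  over.
rewrite -big_seq -esum_sum; last first.
  move=> i r Di _; have [r0|r0] := leP 0%R r; first by rewrite mule_ge0// lee_fin.
  rewrite diracE memNset/= ?mule0// => hr.
  by move: r0; rewrite -hr ltNge fun_ge0.
apply: eq_esum => i Di.
have hi : h (x i) \in fset_set (range h) by rewrite in_fset_set// inE; exists (x i).
rewrite (bigD1_seq _ hi (fset_uniq _))/=.
rewrite diracE mem_set//= mule1 big1 ?adde0// => r rh.
by rewrite diracE memNset ?mule0//= => hr; rewrite hr eqxx in rh.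
Qed.

(** These are the test functions for the lower bound in [integral_dirac_sum]: points are measurable,
    so a non-negative function with finite support is simple. *)
Lemma nnsfun_finite_support (c : T -> R) (S : seq T) :
  (forall t, t \in S -> 0 <= c t)%R ->
  exists h : {nnsfun T >-> R}, forall t, h t = if t \in S then c t else 0%R.
Proof.
elim: S => [|p S IH] c0; first by exists nnsfun0.
have [|h hE] := IH; first by move=> t tS; apply: c0; rewrite in_cons tS orbT.
have [pS|pS] := boolP (p \in S).
  by exists h => t; rewrite in_cons hE; case: eqVneq => // ->; rewrite pS.
exists (add_nnsfun (scale_nnsfun (indic_nnsfun R (mset1 p))
  (c0 p (mem_head p S))) h) => t /=.
rewrite in_cons /= hE mindicE.
case: eqVneq => [->|tp]; first by rewrite mem_set// mulr1 (negbTE pS) addr0.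
by rewrite memNset ?mulr0 ?add0r//; exact/eqP.
Qed.

(** The integral is a difference of suprema over simple functions below the positive and the
    negative part of [f]. Only values at the atoms count: there the negative part vanishes, and each
    finite partial sum of [f] is reached by a simple function supported by the atoms involved. *)
Lemma integral_dirac_sum (f : T -> \bar R) : (forall i, D i -> 0 <= f (x i)) ->
  \int[mu]_t f t = \esum_(i in D) f (x i).
Proof.
move=> f0; rewrite /integral patch_setT.
have -> : ereal_sup [set sintegral mu h | h in
    [set h : {nnsfun T >-> R} | forall t, (h t)%:E <= (f^\-)%E t]] = 0.
  apply/eqP; rewrite eq_le; apply/andP; split; last first.
    apply: ereal_sup_ubound; exists nnsfun0.
      by move=> t /=; rewrite funenegE le_max lexx orbT.
    by rewrite sintegral_dirac_sum esum1.
  apply: ge_ereal_sup => _ [h hf <-]; rewrite sintegral_dirac_sum esum1// => i Di.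
  apply/eqP; rewrite eq_le; apply/andP; split; last by rewrite lee_fin.
  apply: le_trans (hf (x i)) _; rewrite funenegE ge_max lexx andbT.
  by rewrite leeNl oppe0 f0.
rewrite sube0; apply/eqP; rewrite eq_le; apply/andP; split.
  apply: ge_ereal_sup => _ [h hf <-]; rewrite sintegral_dirac_sum.
  apply: le_esum => i Di; apply: le_trans (hf (x i)) _.
  by rewrite funeposE ge_max lexx f0.
apply: ge_ereal_sup => _ [X [finX XD] <-].
rewrite fsbig_finite//=.
have XDi i : i \in fset_set X -> D i.
  by rewrite in_fset_set// inE => /XD.
(* Simple functions are real-valued, so an atom where [f] is infinite is treated apart, with
   arbitrarily large multiples of the indicator of that point. *)
have [/hasP[i iX fi]|/hasPn foo] := boolP (has (fun i => f (x i) == +oo) (fset_set X)).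
  suff -> : ereal_sup [set sintegral mu h | h in
    [set h : {nnsfun T >-> R} | forall t, (h t)%:E <= (f^\+)%E t]] = +oo.
    by rewrite leey.
  apply: eq_infty => r.
  have [|h hE] := @nnsfun_finite_support (fun=> `|r|%R) [:: x i]; first by [].
  apply: le_trans (_ : sintegral mu h <= _).
    rewrite sintegral_dirac_sum.
    apply: le_trans (_ : (h (x i))%:E <= _).
      by rewrite hE mem_head lee_fin ler_norm.
    by apply: (@esum_ge1 _ _ D (fun i => (h (x i))%:E) i); rewrite ?lee_fin//; exact: XDi.
  apply: ereal_sup_ubound; exists h => // t; rewrite hE inE.
  case: eqVneq => [->|_]; first by rewrite funeposE (eqP fi) maxye leey.
  by rewrite funeposE le_max lexx orbT.
have ffin i : i \in fset_set X -> (fine (f (x i)))%:E = f (x i).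
  move=> iX; rewrite fineK// ge0_fin_numE; first by rewrite lt_neqAle foo//= leey.
  by apply: f0; exact: XDi.
have [|h hE] := @nnsfun_finite_support (fun t => fine (f t)) [seq x i | i <- fset_set X].
  by move=> _ /mapP[i iX ->]; rewrite fine_ge0// f0//; exact: XDi.
apply: le_trans (_ : sintegral mu h <= _).
  rewrite sintegral_dirac_sum; apply: esum_ge; exists X => //.
  rewrite fsbig_finite//= big_seq [leRHS]big_seq.
  by apply: lee_sum => i iX; rewrite hE map_f// ffin.
apply: ereal_sup_ubound; exists h => // t; rewrite hE.
case: ifPn => [/mapP[i iX ->]|_]; last by rewrite funeposE le_max lexx orbT.
by rewrite ffin// funeposE le_max lexx.
Qed.

End integral_dirac_sum.

(** * Factorial measures as sums over lists of distinct indices *)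

(** Index lists are plain sequences whose length is only known by a proposition. Padding with [t0]
    makes the passage to tuples total and avoids casts. *)
Definition tup (T : Type) (t0 : T) (k : nat) (s : seq T) : k.-tuple T :=
  [tuple nth t0 s a | a < k].

Definition distinct (I : choiceType) (D : set I) (k : nat) : set (seq I) :=
  [set s | [/\ size s = k, uniq s & forall i, i \in s -> D i]].

Lemma measurable_tuple1 (d : measure_display) (T : measurableType d) (k : nat)
    (X : k.-tuple T) :
  (forall t : T, measurable [set t]) -> measurable [set X].
Proof.
move=> mT; rewrite (_ : [set X] = \bigcap_(i in [set: 'I_k])
    (fun Y : k.-tuple T => tnth Y i) @^-1` [set tnth X i]).
  apply: fin_bigcap_measurable => // i _.
  by rewrite -[X in measurable X]setTI; apply: measurable_tnth.
apply/seteqP; split => [_ -> i _ //|Y YX].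
by apply/eq_from_tnth => i; exact: YX.
Qed.

Lemma tup_cons (T : Type) (t0 : T) k t (s : seq T) :
  tup t0 k.+1 (t :: s) = [tuple of t :: tup t0 k s].
Proof.
apply: eq_from_tnth => i; rewrite tnth_mktuple (tnth_nth t0) /=.
by case: i => -[//|i] /= ik; rewrite (nth_map (Ordinal (ik : (i < k)%N))) ?size_enum_ord// nth_enum_ord.
Qed.

(** This mirrors the recursion of [factorial_measure]: a first index, and then a list in what is
    left. *)
Lemma distinct_cons (I : choiceType) (D : set I) k :
  set_bij (D `*`` (fun i => distinct (D `\ i) k)) (distinct D k.+1)
    (fun p => p.1 :: p.2).
Proof.
split.
- move=> [i s] /= [Di [sk us sD]]; split => //=; first by rewrite sk.
    by rewrite us andbT; apply/negP => /sD[_]; apply.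
  by move=> j; rewrite in_cons => /predU1P[->//|/sD[]].
- by move=> [i s] [j t] _ _ /= [-> ->].
- move=> [|i s] [//= [sk] /andP[is_ us] sD]; exists (i, s) => //=; split.
    by apply: sD; rewrite mem_head.
  split=> // j js; split; first by apply: sD; rewrite in_cons js orbT.
  by move=> /= ji; rewrite -ji js in is_.
Qed.

Lemma val_tup (T : Type) (t0 : T) k (s : seq T) :
  size s = k -> tval (tup t0 k s) = s.
Proof.
move=> sk; apply: (@eq_from_nth _ t0) => [|i]; rewrite size_tuple// => ik.
by have := tnth_nth t0 (tup t0 k s) (Ordinal ik); rewrite tnth_mktuple.
Qed.

Section factorial_dirac_sum.
Context (R : realType) dT (T : measurableType dT) (t0 : T) (I : choiceType).
Variable x : I -> T.
Hypothesis mset1 : forall t : T, measurable [set t].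

(** Subtracting one Dirac mass removes one index; other indices carrying the same point remain. *)
Lemma dirac_sum_minus (mu : set T -> \bar R) (D : set I) i : D i ->
  (forall A, measurable A -> mu A = \esum_(i in D) \d_(x i) A) ->
  forall A, measurable A ->
  mu A - \d_(x i) A = \esum_(j in D `\ i) \d_(x j) A.
Proof.
move=> Di muE A mA; rewrite muE// (esumID [set i])//.
rewrite (_ : D `&` [set i] = [set i]); last first.
  by apply/seteqP; split => [j []//|j ->].
by rewrite esum_set1// -setDE addeC addeK// diracE; case: (_ \in _).
Qed.

(** By induction on [k]: the outer integral is evaluated at the atoms only, and there [mu] minus a
    Dirac mass is again a Dirac sum, over the remaining indices. *)
Lemma factorial_measureE k (mu : set T -> \bar R) (D : set I) :
  (forall A, measurable A -> mu A = \esum_(i in D) \d_(x i) A) ->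
  forall A, measurable A -> factorial_measure (k := k) mu A =
    \esum_(s in distinct D k) \d_(tup t0 k (map x s)) A.
Proof.
elim: k mu D => [|k IH] mu D muE A mA.
  rewrite /= (_ : distinct D 0 = [set [::]]); last first.
    by apply/seteqP; split => [s [/size0nil ->]|_ ->].
  by rewrite esum_set1//= !diracE (tuple0 (tup t0 0 [::])); congr (_ (_ \in _))%:R%:E; apply: tuple0.
have fE i : D i -> factorial_measure (fun B => mu B - \d_(x i) B)
      [set y : k.-tuple T | A [tuple of x i :: y]] =
    \esum_(s in distinct (D `\ i) k) \d_(tup t0 k.+1 (map x (i :: s))) A.
  move=> Di; rewrite (IH _ (D `\ i)); last 2 first.
  - exact: dirac_sum_minus.
  - rewrite -[X in measurable X]setTI.
    by apply: (measurable_cons (f := cst (x i)) (g := id)).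
  by apply: eq_esum => s _; rewrite map_cons tup_cons !diracE; congr (_%:R%:E).
rewrite /= (integral_dirac_sum mset1 muE); last first.
  by move=> i Di; rewrite fE// esum_ge0.
rewrite (eq_esum fE) esum_esum//.
by rewrite (reindex_esum _ _ _ _ (distinct_cons D k)).
Qed.

Lemma ustatE m (mu : set T -> \bar R) (D : set I) (f : m.-tuple T -> R) :
  (forall A, measurable A -> mu A = \esum_(i in D) \d_(x i) A) ->
  (forall X, 0 <= f X)%R ->
  ustat f mu = \esum_(s in distinct D m) (f (tup t0 m (map x s)))%:E.
Proof.
move=> muE f0; rewrite /ustat.
rewrite (integral_dirac_sum _ (factorial_measureE muE))//.
- by move=> X; exact: measurable_tuple1.
- by move=> s _; rewrite lee_fin.
Qed.

End factorial_dirac_sum.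

(** * Locally finite counting measures are sums of Dirac masses *)

Section integer_valued_measure.
Context (R : realType) dT (T : measurableType dT).
Variable mu : {measure set T -> \bar R}.
Variable U : nat -> set T.
Hypothesis mU : forall l, measurable (U l).
Hypothesis Usep : forall s t : T, (forall l, U l s <-> U l t) -> s = t.
Hypothesis mset1 : forall t : T, measurable [set t].

Let integer_on (B : set T) := forall A, measurable A -> A `<=` B ->
  exists n : nat, mu A = n%:R%:E.

(* A set E of minimal positive mass charges exactly one of U l and its
   complement, for every l; the intersection of the charged ones is a point. *)
Lemma integer_measure_atom (B : set T) : measurable B -> integer_on B ->
  mu B != 0 -> exists t, B t /\ mu [set t] != 0.
Proof.
move=> mB iB muB0.
pose Q n := exists E, [/\ measurable E, E `<=` B & mu E = n.+1%:R%:E].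
have Q0 : exists n, `[< Q n >].
  have [n muB] := iB B mB (fun t => id); case: n muB => [muB|n muB].
    by move/eqP: muB0; rewrite muB.
  by exists n; apply/asboolP; exists B; split.
case: (ex_minnP Q0) => n /asboolP[E [mE EB muE]] minn.
have dicho l : mu (E `&` U l) = 0 \/ mu (E `&` ~` U l) = 0.
  have mEU : measurable (E `&` U l) by exact: measurableI.
  have mEC : measurable (E `&` ~` U l) by apply: measurableI => //; exact: measurableC.
  have [a ma] := iB _ mEU (subIset (or_introl EB)).
  have [b mb] := iB _ mEC (subIset (or_introl EB)).
  case: a ma => [|a ma]; first by left.
  right; have /minn na : `[< Q a >].
    by apply/asboolP; exists (E `&` U l); split=> //; exact: subIset (or_introl EB).
  have : mu E = mu (E `&` U l) + mu (E `&` ~` U l).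
    by rewrite addeC -setDE -measureDI.
  rewrite muE ma mb -EFinD -natrD => /eqP; rewrite eqe eqr_nat => /eqP nab.
  by rewrite (_ : b = 0%N)//; lia.
pose V l := if pselect (mu (E `&` U l) = 0) then ~` U l else U l.
have mV l : measurable (V l).
  by rewrite /V; case: pselect => ? /=; [exact: measurableC|].
have muV l : mu (E `&` ~` V l) = 0.
  rewrite /V; case: pselect => [|muU] /=; first by rewrite setCK.
  by have [] := dicho l.
pose F := E `&` \bigcap_l V l.
have mF : measurable F by apply: measurableI => //; exact: bigcapT_measurable.
have muF : mu F = mu E.
  rewrite [RHS](measureDI _ mE (bigcapT_measurable mV)) -/F.
  rewrite [X in _ = X + _](_ : _ = 0) ?add0e//.
  apply: measure_negligible.
    by apply: measurableD => //; exact: bigcapT_measurable.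
  rewrite setDE setC_bigcap setI_bigcupr.
  apply: negligible_bigcup => l; exists (E `&` ~` V l); split => //.
  by apply: measurableI => //; exact: measurableC.
have [F0|/set0P[t Ft]] := eqVneq F set0.
  by move: muF; rewrite F0 measure0 muE => -[] /esym/eqP; rewrite pnatr_eq0.
exists t; split; first by apply: EB; case: Ft.
have Ft1 : F `<=` [set t].
  move=> s Fs; apply: Usep => l; move: (Fs.2 l Logic.I) (Ft.2 l Logic.I).
  by rewrite /V; case: pselect => ? /=; split.
apply/eqP => mut; have : mu F <= mu [set t] by rewrite le_measure ?inE.
by rewrite mut muF muE lee_fin leNgt ltr0Sn.
Qed.

Lemma sum_nseq_dirac m t (A : set T) :
  \sum_(i <- nseq m t) \d_i A = m%:R%:E * \d_t A :> \bar R.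
Proof.
elim: m => [|m IH] /=; first by rewrite big_nil mul0e.
rewrite big_cons IH -[in RHS]addn1 natrD EFinD ge0_muleDl ?lee_fin//.
by rewrite mul1e addeC.
Qed.

(** Strong induction on the integer [mu B]: an atom [t] is removed with its whole mass [m] and is
    listed [m] times. Since [m] is positive, the mass that is left is smaller. *)
Lemma integer_measure_dirac_sum (B : set T) : measurable B -> integer_on B ->
  exists s : seq T, (forall t, t \in s -> B t) /\
    forall A, measurable A -> A `<=` B -> mu A = \sum_(t <- s) \d_t A.
Proof.
move=> mB iB; have [n muB] := iB B mB (fun t => id).
elim/ltn_ind: n B mB iB muB => n IH B mB iB muB.
have [muB0|/(integer_measure_atom mB iB)[t [Bt mut]]] := eqVneq (mu B) 0.
  exists [::]; split => // A mA AB; rewrite big_nil.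
  exact: subset_measure0 AB muB0.
have tB : [set t] `<=` B by move=> _ ->.
have [m mtm] := iB _ (mset1 t) tB.
have mBt : measurable (B `\ t) by exact: measurableD.
have iBt : integer_on (B `\ t).
  by move=> A mA AB; apply: iB => // s /AB[].
have [p mup] := iBt _ mBt (fun t => id).
have npm : n = (p + m)%N.
  apply/eqP; rewrite -(@eqr_nat R) natrD -eqe EFinD -mup -mtm -muB.
  by rewrite (measureDI _ mB (mset1 t)) (setIidr tB).
have [|s [sB muE]] := IH p _ (B `\ t) mBt iBt mup.
  rewrite npm -[X in (X < _)%N]addn0 ltn_add2l lt0n; apply: contra mut => /eqP m0.
  by rewrite mtm m0.
exists (nseq m t ++ s); split.
  by move=> u; rewrite mem_cat mem_nseq => /orP[/andP[_ /eqP->//]|/sB[]].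
move=> A mA AB; rewrite big_cat sum_nseq_dirac/=.
transitivity (mu (A `\` [set t]) + mu (A `&` [set t])); first exact: measureDI.
rewrite muE; [|exact: measurableD|by move=> u [/AB]].
rewrite addeC; congr (_ + _).
  rewrite diracE; have [At|At] := boolP (t \in A).
    by rewrite mule1 -mtm (setIidr _)// => _ ->; exact/set_mem.
  rewrite mule0 (_ : A `&` [set t] = set0) ?measure0//.
  by apply/seteqP; split => // u [Au /= ut]; move/negP: At; apply; rewrite -ut inE.
apply: eq_big_seq => u us; rewrite !diracE; congr (_%:R%:E); congr nat_of_bool.
apply/idP/idP; rewrite !inE; first by case.
by move=> Au; split => //; have [] := sB _ us.
Qed.

End integer_valued_measure.

Section point_process_atoms.
Context (R : realType) (d : nat).

(** The countable separating family that the extraction of atoms requires: half-spaces with rational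
    bounds, enumerated through [unpickle]. A code that decodes to nothing gives [setT], which is
    harmless. *)
Definition halfspace (l : nat) : set (d.-tuple R) :=
  if (choice.unpickle l : option ('I_d * rat)) is Some (i, q) then
    [set X | (tnth X (i : 'I_d) <= ratr (q : rat))%R] else setT.

Lemma measurable_halfspace l : measurable (halfspace l).
Proof.
rewrite /halfspace; case: choice.unpickle => [[i q]|//].
rewrite (_ : [set X | _] = [set: d.-tuple R] `&`
    (fun X : d.-tuple R => tnth X i) @^-1` `]-oo, (ratr q : R)]%classic).
  by apply: measurable_tnth => //; exact: measurable_itv.
by apply/seteqP; split => [X Xq|X [_]] /=; rewrite ?in_itv.
Qed.

Lemma halfspace_separates (s t : d.-tuple R) :
  (forall l, halfspace l s <-> halfspace l t) -> s = t.
Proof.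
move=> st; apply: eq_from_tnth => i; apply/eqP; rewrite eq_le.
wlog suff wl : s t st / (tnth s i <= tnth t i)%R.
  by rewrite !wl// => l; rewrite st.
rewrite leNgt; apply/negP => /rat_in_itvoo[q]; rewrite in_itv/= => /andP[tq qs].
have := st (choice.pickle (i, q)); rewrite /halfspace choice.pickleK/= => -[_ /(_ (ltW tq))].
by rewrite leNgt qs.
Qed.

Lemma measurable_tuple_point (X : d.-tuple R) : measurable [set X].
Proof. by apply: measurable_tuple1 => r; exact: measurable_set1. Qed.

Lemma bounded_borel_sub (B A : set (d.-tuple R)) :
  tbounded B -> measurable A -> A `<=` B -> bounded_borel A.
Proof. by move=> [M BM] mA AB; split => //; exists M => X /AB/BM. Qed.

Definition box (N : nat) : set (d.-tuple R) :=
  [set X | forall i, (`|tnth X i| <= N%:R)%R].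

Lemma bounded_borel_box N : bounded_borel (box N).
Proof.
split; last by exists N%:R => X.
rewrite (_ : box N = \bigcap_(i in [set: 'I_d])
    (fun Y : d.-tuple R => tnth Y i) @^-1` `[(- N%:R)%R : R, N%:R]%classic).
  apply: fin_bigcap_measurable => // i _.
  rewrite -[X in measurable X]setTI.
  exact: (@measurable_tnth _ R d i measurableT _ (measurable_itv _)).
apply/seteqP; split => [X XN i _|X XN i]/=; first by rewrite in_itv/= -ler_norml.
by rewrite ler_norml; have := XN i Logic.I; rewrite /= in_itv.
Qed.

Lemma box_nondecreasing N M : (N <= M)%N -> box N `<=` box M.
Proof. by move=> NM X XN i; rewrite (le_trans (XN i))// ler_nat. Qed.

Lemma box_cover (X : d.-tuple R) : exists N, box N X.
Proof.
exists (\max_(i < d) (Num.truncn `|tnth X i|).+1)%N => i.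
apply: le_trans (ltW (truncnS_gt _)) _; rewrite ler_nat.
exact: (leq_bigmax (F := fun i => (Num.truncn `|tnth X i|).+1)).
Qed.

Lemma bigcup_box : \bigcup_n box n = setT.
Proof. by apply/seteqP; split => // X _; have [N XN] := box_cover X; exists N. Qed.

Context (dO : measure_display) (Om : measurableType dO) (P : probability Om R).
Variable Phi : pointProcess d P.

Lemma pp_restr_atoms w (W : set (d.-tuple R)) (mW : measurable W) :
  tbounded W -> exists s : seq (d.-tuple R), (forall X, X \in s -> W X) /\
    forall A, measurable A -> mrestr (Phi w) mW A = \sum_(X <- s) \d_X A.
Proof.
move=> bW; have [|s [sW PhiE]] := integer_measure_dirac_sum (mu := Phi w)
    measurable_halfspace halfspace_separates measurable_tuple_point mW.
  by move=> A mA AW; apply: pp_count; exact: bounded_borel_sub AW.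
exists s; split => // A mA; rewrite /mrestr PhiE//; last exact: measurableI.
apply: eq_big_seq => X Xs; rewrite !diracE; congr (_%:R%:E); congr nat_of_bool.
by rewrite in_setI andbC mem_set//; exact: sW.
Qed.

(** The space is cut into the successive differences of the boxes. Each of them is bounded and so
    holds finitely many atoms; the index [(l, k)] stands for the atom of rank [k] in the piece of
    rank [l]. *)
Lemma pp_atoms w : exists (D : set (nat * nat)) (x : nat * nat -> d.-tuple R),
  forall A, measurable A -> Phi w A = \esum_(i in D) \d_(x i) A.
Proof.
pose C := seqDU box.
have mC l : measurable (C l).
  apply: measurableD; first exact: (bounded_borel_box l).1.
  by apply: bigsetU_measurable => i _; exact: (bounded_borel_box i).1.
have bC l : tbounded (C l).
  by have [_ [M bM]] := bounded_borel_box l; exists M => X [/bM].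
have /choice[s sE] l := pp_restr_atoms w (mC l) (bC l).
exists [set p | (p.2 < size (s p.1))%N].
pose x p := nth (nseq_tuple d 0%R) (s p.1) p.2; exists x => A mA.
have -> : Phi w A = \sum_(l <oo) mrestr (Phi w) (mC l) A.
  rewrite /mrestr -measure_semi_bigcup//=; last first.
  - by apply: bigcupT_measurable => l; exact: measurableI.
  - exact/trivIset_setIl/trivIset_seqDU.
  - by move=> l; exact: measurableI.
  - by rewrite -setI_bigcupr /C -seqDU_bigcup_eq bigcup_box setIT.
rewrite nneseries_esumT//.
rewrite [in RHS](_ : [set p | _] = setT `*`` (fun l => `I_(size (s l)))).
  rewrite -(esum_esum (a := fun l k => \d_(x (l, k)) A))//.
  apply: eq_esum => l _; rewrite (sE l).2// esum_fset// -fsbig_ord.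
  by rewrite (big_nth (nseq_tuple d 0%R)) big_mkord.
by apply/seteqP; split => [[l k]|[l k] []].
Qed.

End point_process_atoms.

Arguments measurable_tuple_point {R d} X.

(** * Grid functions *)

(* The number of tuples of distinct points with labels t, when N c points carry
   the label c. Taking positive parts makes it increasing and directionally
   convex in N on the whole of R^C, and not only on integer vectors. *)
Fixpoint label_poly (R : realType) (C : eqType) (N : C -> R) (t : seq C) : R :=
  if t is c :: t' then
    (Num.max (N c - (count_mem c t')%:R) 0 * label_poly N t')%R
  else 1%R.

(** Here the tail is chosen before the head, as in [label_poly], where the factor of the head
    discounts the labels already used by the tail. *)
Lemma distinct_cons_fresh (I : choiceType) (D : set I) k :
  set_bij (distinct D k `*`` (fun s => D `\` [set` s])) (distinct D k.+1)
    (fun p => p.2 :: p.1).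
Proof.
split.
- move=> [s i] /= [[sk us sD] [Di /negP is_]]; split => //=; first by rewrite sk.
    by rewrite us andbT.
  by move=> j; rewrite in_cons => /predU1P[->//|/sD].
- by move=> [s i] [t j] _ _ /= [-> ->].
- move=> [|i s] [//= [sk] /andP[is_ us] sD]; exists (s, i) => //=; split.
    by split => // j js; apply: sD; rewrite in_cons js orbT.
  by split; [apply: sD; rewrite mem_head|exact/negP].
Qed.

(* Given distinct indices s with labels t, exactly [N c - count_mem c t] of the
   remaining indices carry the label c. *)
Lemma label_count (R : realType) (I : choiceType) (D : set I) (C : eqType)
    (b : I -> C) (N : C -> R) :
  (forall c, \esum_(i in D) (b i == c)%:R%:E = (N c)%:E) ->
  forall t, \esum_(s in distinct D (size t)) (map b s == t)%:R%:E =
    (label_poly N t)%:E.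
Proof.
move=> bN; elim=> [|c t IH] /=.
  rewrite (_ : distinct D 0 = [set [::]]) ?esum_set1//.
  by apply/seteqP; split => [s [/size0nil ->]|_ ->].
rewrite (reindex_esum _ _ _ _ (distinct_cons_fresh D (size t))).
rewrite -(esum_esum (a := fun s i => (b i :: map b s == c :: t)%:R%:E))//.
rewrite EFinM muleC -IH mule_esuml; last 2 first.
- by rewrite lee_fin le_max lexx orbT.
- by move=> s _; rewrite lee_fin.
apply: eq_esum => s [sk us sD].
have [st|st] := eqVneq (map b s) t; last first.
  by rewrite mul0e esum1// => i _; rewrite eqseq_cons (negbTE st) andbF.
rewrite mul1e; under eq_esum => i _ do rewrite eqseq_cons st eqxx andbT.
have sE : \esum_(i in [set` s]) (b i == c)%:R%:E = (count_mem c t)%:R%:E :> \bar R.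
  rewrite esum_fset//.
  rewrite -fsbig_seq//= sumEFin; congr EFin.
  rewrite -st count_map -sum1_count natr_sum [RHS]big_mkcond.
  by apply: eq_bigr => i _ /=; case: eqP.
have := bN c; rewrite (esumID [set` s])//.
rewrite (setIidr _); last by move=> i /sD.
rewrite sE -setDE => NE.
have rE : \esum_(i in D `\` [set` s]) (b i == c)%:R%:E =
    (N c - (count_mem c t)%:R)%:E.
  by rewrite EFinB -NE addeAC subee// add0e.
(* The positive part changes nothing here: the difference is a sum of non-negative terms, one for
   each index still available. *)
rewrite rE; congr EFin; rewrite max_l// -lee_fin -rE.
by apply: esum_ge0 => i _; rewrite lee_fin.
Qed.

Section grid.
Context (R : realType) dT (T : measurableType dT) (m : nat).

(** Functions that only see the cells of a finite measurable partition, the same for every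
    coordinate. The target is arbitrary so that real kernels and, through booleans, sets are covered
    at once. *)
Definition grid (V : Type) (u : m.-tuple T -> V) : Prop :=
  exists (C : finType) (a : T -> C) (phi : m.-tuple C -> V),
    (forall c, measurable (a @^-1` [set c])) /\
    forall X, u X = phi (map_tuple a X).

Lemma grid_comp (V V' : Type) (h : V -> V') (u : m.-tuple T -> V) :
  grid u -> grid (h \o u).
Proof.
move=> [C [a [phi [ma uE]]]]; exists C, a, (h \o phi); split => // X.
by rewrite /= uE.
Qed.

Lemma grid_comp2 (V V' V'' : Type) (h : V -> V' -> V'') (u : m.-tuple T -> V)
    (v : m.-tuple T -> V') :
  grid u -> grid v -> grid (fun X => h (u X) (v X)).
Proof.
move=> [C [a [phi [ma uE]]]] [C' [a' [phi' [ma' vE]]]].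
exists (C * C')%type, (fun t => (a t, a' t)),
  (fun t => h (phi (map_tuple fst t)) (phi' (map_tuple snd t))); split.
  move=> [c c']; rewrite (_ : _ @^-1` _ = a @^-1` [set c] `&` a' @^-1` [set c']).
    exact: measurableI.
  by apply/seteqP; split => [t [<- <-]|t /= [-> ->]].
move=> X; rewrite uE vE; congr (h (phi _) (phi' _)); apply: val_inj => /=;
  by rewrite -map_comp.
Qed.

Lemma grid_cst (V : Type) (v : V) : grid (fun=> v).
Proof.
exists unit, (fun=> tt), (fun=> v); split => // -[].
by rewrite (_ : _ @^-1` _ = setT)//; apply/seteqP; split.
Qed.

Lemma grid_coord (i : 'I_m) (B : set T) : measurable B ->
  grid (fun X => tnth X i \in B).
Proof.
move=> mB; exists bool, (fun t => t \in B), (fun t => tnth t i); split; last first.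
  by move=> X; rewrite tnth_map.
move=> -[].
  by rewrite (_ : _ @^-1` _ = B)//; apply/seteqP; split => t /= => [/set_mem|/mem_set].
rewrite (_ : _ @^-1` _ = ~` B); first exact: measurableC.
by apply/seteqP; split => t /= => [/negbT/negP tB /mem_set|tB]//; exact: memNset.
Qed.

Lemma grid_sum (J : Type) (r : seq J) (u : J -> m.-tuple T -> R) :
  (forall j, grid (u j)) -> grid (fun X => \sum_(j <- r) u j X)%R.
Proof.
move=> gu; elim: r => [|j r IH].
  by under eq_fun do rewrite big_nil; exact: grid_cst.
by under eq_fun do rewrite big_cons; exact: grid_comp2.
Qed.

Lemma grid_prod (J : Type) (r : seq J) (u : J -> m.-tuple T -> R) :
  (forall j, grid (u j)) -> grid (fun X => \prod_(j <- r) u j X)%R.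
Proof.
move=> gu; elim: r => [|j r IH].
  by under eq_fun do rewrite big_nil; exact: grid_cst.
by under eq_fun do rewrite big_cons; exact: grid_comp2.
Qed.

Lemma grid_measurable (V : Type) (u : m.-tuple T -> V) (Y : set V) :
  grid u -> measurable (u @^-1` Y).
Proof.
move=> [C [a [phi [ma uE]]]].
rewrite (_ : _ @^-1` _ = \bigcup_(t in phi @^-1` Y)
    \bigcap_(i in [set: 'I_m]) (fun X : m.-tuple T => tnth X i) @^-1`
      (a @^-1` [set tnth t i])).
  apply: fin_bigcup_measurable => // t _.
  apply: fin_bigcap_measurable => // i _.
  rewrite -[X in measurable X]setTI; exact: measurable_tnth.
apply/seteqP; split => [X|X [t tY] Xt].
  by rewrite /= uE => YX; exists (map_tuple a X) => // i _ /=; rewrite tnth_map.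
rewrite /= uE (_ : map_tuple a X = t)//; apply: eq_from_tnth => i.
by rewrite tnth_map; exact: Xt.
Qed.

(** The finite unions of rectangles on a common finite partition. They are stable under intersection
    and generate the product sigma-algebra; this serves both the Dynkin argument for measurability
    and the approximation of kernels. *)
Definition grid_sets : set_system (m.-tuple T) :=
  [set G : set (m.-tuple T) | grid (fun X => X \in G)].

Lemma measurable_grid_sets : @measurable _ (m.-tuple T) = <<s grid_sets >>.
Proof.
apply/seteqP; split.
- apply: smallest_sub; first exact: smallest_sigma_algebra.
  rewrite -bigcup_seq => A [i _] [B mB <-]; apply: sub_gen_smallest.
  rewrite /grid_sets/= setTI.
  by have [C [a [phi [ma h]]]] := grid_coord i mB; exists C, a, phi; split => // X;
    rewrite -h; apply/idP/idP; rewrite !inE.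
- apply: smallest_sub; first exact: sigma_algebra_measurable.
  move=> G gG; rewrite (_ : G = (fun X => X \in G) @^-1` [set true]).
    exact: grid_measurable.
  by apply/seteqP; split => X /= => [/mem_set|/set_mem].
Qed.

Lemma setI_closed_grid_sets : setI_closed grid_sets.
Proof.
move=> A B gA gB; rewrite /grid_sets/=.
under eq_fun do rewrite in_setI; exact: grid_comp2.
Qed.

End grid.

Section ustat_grid.
Context (R : realType) dT (T : measurableType dT) (t0 : T) (I : choiceType).
Variables (x : I -> T) (D : set I) (mu : set T -> \bar R).
Hypothesis mset1 : forall t : T, measurable [set t].
Hypothesis muE : forall A, measurable A -> mu A = \esum_(i in D) \d_(x i) A.

(** The kernel is constant on the index tuples with a given label sequence [t], and [label_poly N t]
    counts those tuples. *)
Lemma ustat_grid (C : finType) (a : T -> C) m (phi : m.-tuple C -> R)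
    (N : C -> R) :
  (forall c, measurable (a @^-1` [set c])) ->
  (forall c, mu (a @^-1` [set c]) = (N c)%:E) ->
  (forall t, 0 <= phi t)%R ->
  ustat (fun X => phi (map_tuple a X)) mu =
    (\sum_(t : m.-tuple C) phi t * label_poly N t)%:E.
Proof.
move=> ma muN phi0; rewrite (ustatE t0 mset1 muE)//.
have bN c : \esum_(i in D) ((a \o x) i == c)%:R%:E = (N c)%:E.
  rewrite -muN muE//; apply: eq_esum => i _; rewrite diracE.
  by congr (_%:R%:E); congr nat_of_bool; apply/eqP/idP; rewrite inE.
transitivity (\esum_(s in distinct D m) \sum_(t : m.-tuple C)
    (phi t)%:E * (map (a \o x) s == t)%:R%:E).
  apply: eq_esum => s [sm _ _].
  have sE : tval (map_tuple a (tup t0 m (map x s))) = map (a \o x) s.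
    by rewrite [LHS]/= val_tup ?size_map// -map_comp.
  rewrite (bigD1 (map_tuple a (tup t0 m (map x s))))//= sE eqxx mule1.
  rewrite big1 ?adde0// => t tE; rewrite (_ : _ == _ = false) ?mule0//.
  by apply: contraNF tE => /eqP st; apply/eqP/val_inj => /=; rewrite -st -sE.
rewrite esum_sum; last by move=> s t _ _; rewrite mule_ge0 ?lee_fin.
rewrite -sumEFin; apply: eq_bigr => t _.
rewrite -mule_esumr ?lee_fin//.
by rewrite EFinM -(label_count bN) size_tuple.
Qed.

End ustat_grid.

(** * Measurability of factorial measures *)

Lemma esum_exchange (R : realType) (I J : choiceType) (A : set I) (B : set J)
    (a : I -> J -> \bar R) : (forall i j, 0 <= a i j) ->
  \esum_(i in A) \esum_(j in B) a i j = \esum_(j in B) \esum_(i in A) a i j.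
Proof.
move=> a0; rewrite !esum_esum//.
rewrite (reindex_esum (B `*`` (fun=> A)) _ (fun p => (p.2, p.1)))//; split=> //=.
- by move=> [j i] [].
- by move=> [j1 i1] [j2 i2] _ _ /= [-> ->].
- by move=> [i j] [Ai Bj]; exists (j, i).
Qed.

Lemma esum_subset (R : realType) (I : choiceType) (A B : set I)
    (a : I -> \bar R) : A `<=` B -> \esum_(i in A) a i <= \esum_(i in B) a i.
Proof.
move=> AB; apply: ge_ereal_sup => _ [X [finX XA] <-].
by apply: ereal_sup_ubound; exists X => //; split => // i /XA/AB.
Qed.

(** A finite subset of the increasing union lies in one [S N], so every finite partial sum is
    eventually reached. *)
Lemma cvg_esum (R : realType) (I : choiceType) (S : nat -> set I)
    (a : I -> \bar R) :
  (forall n m, (n <= m)%N -> S n `<=` S m) ->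
  \esum_(i in S n) a i @[n --> \oo] --> \esum_(i in \bigcup_n S n) a i.
Proof.
move=> ndS.
have nd : nondecreasing_seq (fun n => \esum_(i in S n) a i).
  by move=> n m nm; apply: esum_subset; exact: ndS.
rewrite (_ : \esum_(i in _) _ = ereal_sup (range (fun n => \esum_(i in S n) a i))).
  exact: ereal_nondecreasing_cvgn.
apply/eqP; rewrite eq_le; apply/andP; split; last first.
  by apply: ge_ereal_sup => _ [n _ <-]; apply: esum_subset => i Si; exists n.
apply: ge_ereal_sup => _ [X [finX XS] <-].
have [N XN] : exists N, X `<=` S N.
  suff [N XN] : exists N, forall i, i \in (fset_set X : seq I) -> S N i.
    by exists N => i Xi; apply: XN; rewrite in_fset_set ?inE.
  have : forall i, i \in (fset_set X : seq I) -> exists N, S N i.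
    by move=> i; rewrite in_fset_set// inE => /XS[N _ Si]; exists N.
  elim: (fset_set X : seq I) => [_|i s IH h]; first by exists 0%N.
  have [|N HN] := IH; first by move=> j js; apply: h; rewrite in_cons js orbT.
  have [M Mi] := h i (mem_head _ _).
  exists (maxn N M) => j; rewrite in_cons => /predU1P[->|/HN].
    by apply: ndS Mi; rewrite leq_maxr.
  by apply: ndS; rewrite leq_maxl.
apply: le_trans (_ : \esum_(i in S N) a i <= _).
  by apply: ereal_sup_ubound; exists X.
by apply: ereal_sup_ubound; exists N.
Qed.

Lemma distinct_bigcup (I : choiceType) (S : nat -> set I) k :
  (forall n m, (n <= m)%N -> S n `<=` S m) ->
  distinct (\bigcup_n S n) k = \bigcup_n distinct (S n) k.
Proof.
move=> ndS; apply/seteqP; split => [s [sm us sD]|s [n _ [sm us sD]]]; last first.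
  by split => // i /sD; exists n.
suff [n Hn] : exists n, forall i, i \in s -> S n i by exists n.
elim: s {sm us} sD => [|i s IH] sD; first by exists 0%N.
have [|n Hn] := IH; first by move=> j js; apply: sD; rewrite in_cons js orbT.
have [p _ Hp] := sD i (mem_head _ _).
exists (maxn n p) => j; rewrite in_cons => /predU1P[->|/Hn].
  by apply: ndS Hp; rewrite leq_maxr.
by apply: ndS; rewrite leq_maxl.
Qed.

Lemma mrestr_dirac_sum (R : realType) d (T : measurableType d) (I : choiceType)
    (D : set I) (x : I -> T) (mu : set T -> \bar R) (V : set T)
    (mV : measurable V) :
  (forall A, measurable A -> mu A = \esum_(i in D) \d_(x i) A) ->
  forall A, measurable A ->
  mrestr mu mV A = \esum_(i in D `&` x @^-1` V) \d_(x i) A.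
Proof.
move=> muE A mA; rewrite /mrestr muE; last exact: measurableI.
rewrite esum_mkcondr; apply: eq_esum => i Di; rewrite !diracE in_setI.
rewrite (_ : (i \in x @^-1` V) = (x i \in V)); last first.
  by apply/idP/idP; rewrite !inE.
by case: (_ \in V); rewrite ?andbT ?andbF.
Qed.

Section dirac_esum.
Context (R : realType) d (T : measurableType d) (J : choiceType).
Variables (S : set J) (y : J -> T).

(** Packaged as a measure in order to apply continuity, additivity and the convergence theorems to
    [factorial_measure], a bare set function that agrees with such a sum on measurable sets. *)
Definition dirac_esum (A : set T) : \bar R := \esum_(j in S) \d_(y j) A.

Let dirac_esum0 : dirac_esum set0 = 0.
Proof. by rewrite /dirac_esum esum1// => j _; rewrite dirac0. Qed.

Let dirac_esum_ge0 A : 0 <= dirac_esum A.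
Proof. exact: esum_ge0. Qed.

Let dirac_esum_sigma_additive : semi_sigma_additive dirac_esum.
Proof.
move=> F mF tF mUF; rewrite [X in _ --> X](_ : _ = \sum_(n <oo) dirac_esum (F n)).
  by apply: is_cvg_nneseries => n _ _; exact: dirac_esum_ge0.
rewrite nneseries_esumT// /dirac_esum esum_exchange//.
apply: eq_esum => j _.
by rewrite -nneseries_esumT// measure_semi_bigcup.
Qed.

HB.instance Definition _ := isMeasure.Build _ _ _ dirac_esum
  dirac_esum0 dirac_esum_ge0 dirac_esum_sigma_additive.

End dirac_esum.

Section factorial_measurable.
Context (R : realType) (d : nat).
Local Notation T := (d.-tuple R).
Local Notation t0 := (nseq_tuple d (0%R : R)).
Context (dO : measure_display) (Om : measurableType dO) (P : probability Om R).
Variable Phi : pointProcess d P.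

Lemma factorial_measure_ustat (I : choiceType) (D : set I) (x : I -> T)
    (mu : set T -> \bar R) m (A : set (m.-tuple T)) :
  (forall A, measurable A -> mu A = \esum_(i in D) \d_(x i) A) ->
  measurable A -> factorial_measure mu A = ustat \1_A mu.
Proof.
move=> muE mA; rewrite (factorial_measureE t0 measurable_tuple_point muE)//.
by rewrite (ustatE t0 measurable_tuple_point muE)// => X; rewrite indicE.
Qed.

Section restriction.
Variables (W : set T) (mW : measurable W).
Hypothesis bW : tbounded W.

Lemma pp_restr_dirac w : exists (n : nat) (x : nat -> T),
  (forall i, (i < n)%N -> W (x i)) /\
  forall A, measurable A ->
    mrestr (Phi w) mW A = \esum_(i in `I_n) \d_(x i) A.
Proof.
have [s [sW sE]] := pp_restr_atoms Phi w mW bW.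
exists (size s), (nth t0 s); split => [i /(mem_nth t0)/sW//|A /sE ->].
by rewrite esum_fset// -fsbig_ord (big_nth t0) big_mkord.
Qed.

Lemma mrestr_fine w A : measurable A ->
  mrestr (Phi w) mW A = (fine (Phi w (A `&` W)))%:E.
Proof.
move=> mA; rewrite /mrestr; have [|n ->//] := pp_count Phi w (B := A `&` W).
by apply: bounded_borel_sub (bW) _ _ => //; exact: measurableI.
Qed.

Lemma measurable_pp_fine B : measurable B ->
  measurable_fun setT (fun w => fine (Phi w B)).
Proof.
move=> mB; apply: (measurableT_comp (fine_measurable _)) => //.
exact: pp_measurable.
Qed.

Lemma ustat_restr_grid (C : finType) (a : T -> C) m (phi : m.-tuple C -> R) w :
  (forall c, measurable (a @^-1` [set c])) -> (forall t, 0 <= phi t)%R ->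
  ustat (fun X => phi (map_tuple a X)) (mrestr (Phi w) mW) =
  (\sum_(t : m.-tuple C)
     phi t * label_poly (fun c => fine (Phi w (a @^-1` [set c] `&` W))) t)%:E.
Proof.
move=> ma phi0; have [n [x [xW xE]]] := pp_restr_dirac w.
by apply: (ustat_grid t0 measurable_tuple_point xE) => // c; rewrite mrestr_fine.
Qed.

Lemma measurable_label_poly (C : eqType) (N : Om -> C -> R) (t : seq C) :
  (forall c, measurable_fun setT (N ^~ c)) ->
  measurable_fun setT (fun w => label_poly (N w) t).
Proof.
move=> mN; elim: t => [|c t IH] /=; first exact: measurable_cst.
apply: measurable_funM => //; apply: measurable_maxr => //.
exact: measurable_funB.
Qed.

Lemma measurable_ustat_grid m (u : m.-tuple T -> R) :
  grid u -> (forall X, 0 <= u X)%R ->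
  measurable_fun setT (fun w => ustat u (mrestr (Phi w) mW)).
Proof.
move=> [C [a [phi [ma uE]]]] u0.
(* [phi] may be negative on label tuples that no point realizes; its positive part represents the
   same kernel. *)
have -> : u = (fun X => Num.max (phi (map_tuple a X)) 0%R).
  by apply/funext => X; rewrite -uE max_l.
have phi0 t : (0 <= Num.max (phi t) 0%R)%R by rewrite le_max lexx orbT.
rewrite (funext (fun w => ustat_restr_grid w ma phi0)).
apply/measurable_EFinP; apply: measurable_sum => t.
apply: measurable_funM => //; apply: measurable_label_poly => c.
by apply: measurable_pp_fine; exact: measurableI.
Qed.

(** It suffices to bound the total mass, which is the U-statistic of the constant 1: a grid kernel
    with a single label, whose value is an explicit real number. *)
Lemma factorial_restr_fin_num m w (A : set (m.-tuple T)) : measurable A ->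
  factorial_measure (mrestr (Phi w) mW) A \is a fin_num.
Proof.
move=> mA; have [n [x [xW xE]]] := pp_restr_dirac w.
have : factorial_measure (mrestr (Phi w) mW) [set: m.-tuple T] \is a fin_num.
  rewrite (factorial_measure_ustat xE)// indicT.
  have mtt (c : unit) : measurable ((fun=> tt) @^-1` [set c] : set T).
    by rewrite (_ : _ @^-1` _ = setT)//; apply/seteqP; split => // t _; case: c.
  have := @ustat_restr_grid unit (fun=> tt) m (fun=> 1%R) w mtt (fun=> ler01).
  by rewrite /= -/(cst 1%R) => ->.
rewrite !(factorial_measureE t0 measurable_tuple_point xE)//.
rewrite !ge0_fin_numE ?esum_ge0//; apply: le_lt_trans; apply: le_esum => s _.
by rewrite !diracE in_setT lee_fin; case: (_ \in _).
Qed.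

(** Dynkin induction from the grid sets, for which the mass is a polynomial expression in positive
    parts of counts. The complement is handled by subtraction, legitimate because the masses are
    finite on a bounded window. *)
Lemma measurable_factorial_restr m (A : set (m.-tuple T)) : measurable A ->
  measurable_fun setT (fun w => factorial_measure (mrestr (Phi w) mW) A).
Proof.
move=> mA.
have grid_case (S : set (m.-tuple T)) : grid (fun X => X \in S) -> measurable S ->
    measurable_fun setT (fun w => factorial_measure (mrestr (Phi w) mW) S).
  move=> gS mS; rewrite (_ : (fun w => _) = (fun w => ustat \1_S (mrestr (Phi w) mW))).
    apply: measurable_ustat_grid => [|X]; last by rewrite indicE.
    rewrite (_ : \1_S = (fun b : bool => b%:R) \o (fun X => X \in S)).
      exact: grid_comp.
    by apply/funext => X; rewrite indicE.
  apply/funext => w; have [n [x [xW xE]]] := pp_restr_dirac w.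
  exact: factorial_measure_ustat xE _.
have kE w : exists (J : set (seq nat)) (y : seq nat -> m.-tuple T),
    forall S, measurable S ->
      factorial_measure (mrestr (Phi w) mW) S = dirac_esum R J y S.
  have [n [x [xW xE]]] := pp_restr_dirac w.
  exists (distinct `I_n m), (fun s => tup t0 m (map x s)) => S mS.
  by rewrite (factorial_measureE t0 measurable_tuple_point xE).
have mT : measurable_fun setT
    (fun w => factorial_measure (mrestr (Phi w) mW) [set: m.-tuple T]).
  by apply: grid_case => //; under eq_fun do rewrite in_setT; exact: grid_cst.
apply: (dynkin_induction (measurable_grid_sets _ m) (@setI_closed_grid_sets _ T m)
  (P := fun S => measurable_fun setT
    (fun w => factorial_measure (mrestr (Phi w) mW) S))) => //.
- move=> S gS; apply: grid_case => //.
  by rewrite measurable_grid_sets; exact: sub_gen_smallest.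
- move=> S mS PS; rewrite (_ : (fun w => _) = (fun w =>
      factorial_measure (mrestr (Phi w) mW) [set: m.-tuple T] -
      factorial_measure (mrestr (Phi w) mW) S)); first exact: emeasurable_funB.
  apply/funext => w; have := factorial_restr_fin_num w mS.
  have [J [y yE]] := kE w; rewrite !yE//; last exact: measurableC.
  move=> Sfin; have := measureDI (dirac_esum R J y) (@measurableT _ _) mS.
  by move=> ->; rewrite setTI setTD addeK.
- move=> F mF tF PF; rewrite (_ : (fun w => _) = (fun w =>
      \sum_(k <oo) factorial_measure (mrestr (Phi w) mW) (F k))); last first.
    apply/funext => w; have [J [y yE]] := kE w.
    rewrite yE; last exact: bigcupT_measurable.
    rewrite measure_semi_bigcup//; last exact: bigcupT_measurable.
    by apply: eq_eseriesr => k _; rewrite yE.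
  apply: ge0_emeasurable_sum => // k w _ _; have [J [y ->]] := kE w => //.
- by rewrite -measurable_grid_sets.
Qed.

End restriction.

(** Limit along the boxes: a list of indices is finite, so its points all lie in one box. *)
Lemma measurable_factorial m (A : set (m.-tuple T)) : measurable A ->
  measurable_fun setT (fun w => factorial_measure (Phi w) A).
Proof.
move=> mA.
pose f n w := factorial_measure (mrestr (Phi w) (bounded_borel_box R d n).1) A.
apply: (emeasurable_fun_cvg f).
  by move=> n; apply: measurable_factorial_restr => //; exact: (bounded_borel_box _ _ n).2.
move=> w _; have [D [x xE]] := pp_atoms Phi w.
rewrite (factorial_measureE t0 measurable_tuple_point xE)//.
pose D' n := D `&` x @^-1` box n.
rewrite (_ : f ^~ w = fun n => \esum_(s in distinct (D' n) m) \d_(tup t0 m (map x s)) A).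
  have D'nd n p : (n <= p)%N -> D' n `<=` D' p.
    by move=> np i [Di xi]; split => //; exact: box_nondecreasing xi.
  rewrite (_ : D = \bigcup_n D' n); last first.
    by rewrite -setI_bigcupr -preimage_bigcup bigcup_box preimage_setT setIT.
  rewrite distinct_bigcup//; apply: cvg_esum => n p np s [sm us sD].
  by split => // i /sD; exact: D'nd.
apply/funext => n; apply: (factorial_measureE t0 measurable_tuple_point) => // B mB.
exact: mrestr_dirac_sum.
Qed.

End factorial_measurable.

(** Both integrals are the same sum over the atoms; this exchanges a bare set function for a genuine
    measure under the integral sign. *)
Lemma eq_integral_dirac_esum (R : realType) d (T : measurableType d)
    (J : choiceType) (S : set J) (y : J -> T) (mu : set T -> \bar R)
    (G : T -> \bar R) :
  (forall t : T, measurable [set t]) ->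
  (forall A, measurable A -> mu A = dirac_esum R S y A) ->
  (forall t, 0 <= G t) -> \int[mu]_t G t = \int[dirac_esum R S y]_t G t.
Proof.
move=> mT muE G0; rewrite (integral_dirac_sum mT muE)//.
by rewrite (integral_dirac_sum (mu := dirac_esum R S y) (D := S) (x := y) mT).
Qed.

(** * Monotonicity of expected integrals in the factorial moment measure *)

Section factorial_integral.
Context (R : realType) (d : nat).
Local Notation T := (d.-tuple R).
Local Notation t0 := (nseq_tuple d (0%R : R)).
Context (j : nat) (G : j.-tuple T -> \bar R).
Hypothesis mG : measurable_fun setT G.
Hypothesis G0 : forall X, 0 <= G X.

Import HBNNSimple.

Let Gn n := nnsfun_approx measurableT mG n.

Section one_process.
Context (dO : measure_display) (Om : measurableType dO) (P : probability Om R).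
Variable Phi : pointProcess d P.

Let fm w : set (j.-tuple T) -> \bar R := factorial_measure (Phi w).

Let fmE w : exists (J : set (seq (nat * nat))) (y : seq (nat * nat) -> j.-tuple T),
  forall S, measurable S -> fm w S = dirac_esum R J y S.
Proof.
have [D [x xE]] := pp_atoms Phi w.
exists (distinct D j), (fun s => tup t0 j (map x s)) => S mS.
by rewrite /fm (factorial_measureE t0 measurable_tuple_point xE).
Qed.

Let mpt (X : j.-tuple T) : measurable [set X].
Proof. by apply: measurable_tuple1; exact: measurable_tuple_point. Qed.

Let A n w := \int[fm w]_X (Gn n X)%:E.

(** The absolute value is the identity on the range of [Gn n]. It makes every coefficient
    non-negative for all [r], as integration term by term requires. *)
Let AE n w : A n w = \sum_(r <- fset_set (range (Gn n)))
  `|r|%:E * fm w (Gn n @^-1` [set r]).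
Proof.
have [J [y yE]] := fmE w.
rewrite /A (eq_integral_dirac_esum mpt yE); last by move=> X; rewrite lee_fin.
rewrite integral_nnsfun// patch_setT sintegralE fsbig_finite//=.
rewrite big_seq [RHS]big_seq; apply: eq_bigr => r.
rewrite in_fset_set// inE => -[X _ <-].
by rewrite yE// ger0_norm.
Qed.

Let mA n : measurable_fun setT (A n).
Proof.
rewrite (funext (AE n)); apply: emeasurable_sum => r.
by apply: measurable_funeM; exact: measurable_factorial.
Qed.

Let A_ge0 n w : 0 <= A n w.
Proof.
have [J [y yE]] := fmE w; rewrite /A (eq_integral_dirac_esum mpt yE).
  by apply: integral_ge0 => X _; rewrite lee_fin.
by move=> X; rewrite lee_fin.
Qed.

Let cvgA w : A n w @[n --> \oo] --> \int[fm w]_X G X.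
Proof.
have [J [y yE]] := fmE w; rewrite (eq_integral_dirac_esum mpt yE)//.
rewrite (_ : A ^~ w = fun n => \int[dirac_esum R J y]_X (Gn n X)%:E); last first.
  apply/funext => n; rewrite /A (eq_integral_dirac_esum mpt yE)// => X.
  by rewrite lee_fin.
apply: (@cvg_trans _ ((fun n => \int[dirac_esum R J y]_X (Gn n X)%:E) @ \oo)) => //.
rewrite (_ : \int[_]_X G X = \int[dirac_esum R J y]_X limn (fun n => (Gn n X)%:E)).
  apply: cvg_monotone_convergence => //.
  - by move=> n; apply/measurable_EFinP.
  - by move=> n X _; rewrite lee_fin.
  - by move=> X _ n p np; rewrite lee_fin; apply/lefP/nd_nnsfun_approx.
apply: eq_integral => X _; apply/esym/cvg_lim => //.
exact: (cvg_nnsfun_approx measurableT mG (fun X _ => G0 X)).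
Qed.

Let ndA w : nondecreasing_seq (A ^~ w).
Proof.
move=> n p np; have [J [y yE]] := fmE w.
rewrite /A !(eq_integral_dirac_esum mpt yE); [|by move=> X; rewrite lee_fin..].
apply: ge0_le_integral => //.
- by move=> X _; rewrite lee_fin.
- by apply/measurable_EFinP.
- by apply/measurable_EFinP.
- by move=> X _; rewrite lee_fin; apply/lefP/nd_nnsfun_approx.
Qed.

Lemma measurable_factorial_integral :
  measurable_fun setT (fun w => \int[factorial_measure (Phi w)]_X G X).
Proof.
by apply: (emeasurable_fun_cvg A) => // w _; exact: cvgA.
Qed.

Lemma factorial_integral_ge0 w : 0 <= \int[factorial_measure (Phi w)]_X G X.
Proof.
have [J [y yE]] := fmE w; rewrite (eq_integral_dirac_esum mpt yE)//.
exact: integral_ge0.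
Qed.

(** Monotone convergence is used twice, against the factorial measure and under [P]. The
    approximants are non-negative combinations of values of the factorial moment measure, so an
    inequality between moment measures passes to the limit. *)
Lemma factorial_moment_cvg :
  \sum_(r <- fset_set (range (Gn n))) `|r|%:E *
    factorial_moment P (fun w => Phi w) (Gn n @^-1` [set r]) @[n --> \oo] -->
  \int[P]_w \int[factorial_measure (Phi w)]_X G X.
Proof.
rewrite (_ : (fun n => _) = fun n => \int[P]_w A n w); last first.
  apply/funext => n; rewrite (eq_integral _ _ (fun w _ => AE n w)).
  rewrite ge0_integral_sum//=.
  - apply: eq_bigr => r _; rewrite ge0_integralZl//.
    + exact: measurable_factorial.
    + by move=> w _; have [J [y ->]] := fmE w.
  - by move=> r; apply: measurable_funeM; exact: measurable_factorial.
  - by move=> r w _; rewrite mule_ge0//; have [J [y ->]] := fmE w.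
rewrite (_ : \int[P]_w _ = \int[P]_w limn (A ^~ w)).
  by apply: cvg_monotone_convergence => // w _; exact: ndA.
by apply: eq_integral => w _; apply/esym/cvg_lim => //; exact: cvgA.
Qed.

End one_process.

Section two_processes.
Context (d1 d2 : measure_display)
  (Om1 : measurableType d1) (Om2 : measurableType d2)
  (P1 : probability Om1 R) (P2 : probability Om2 R)
  (Phi1 : pointProcess d P1) (Phi2 : pointProcess d P2).

Lemma le_factorial_integral :
  (forall A : set (j.-tuple T), measurable A ->
     factorial_moment P1 (fun w => Phi1 w) A
     <= factorial_moment P2 (fun w => Phi2 w) A) ->
  \int[P1]_w \int[factorial_measure (Phi1 w)]_X G X <=
  \int[P2]_w \int[factorial_measure (Phi2 w)]_X G X.
Proof.
move=> le12.
have c1 := @factorial_moment_cvg _ _ P1 Phi1.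
have c2 := @factorial_moment_cvg _ _ P2 Phi2.
apply: (lee_cvg_to c1 c2).
apply: nearW => n; apply: lee_sum => r _.
by rewrite lee_wpmul2l// le12.
Qed.

End two_processes.

End factorial_integral.

(** * Expansion of products of sums by coincidence patterns *)

(* The flag b asks that, moreover, the tuples of the family be pairwise distinct:
   this is what the factorial powers of eta require. *)
Definition admissible (I : eqType) (b : bool) (ss : seq (seq I)) : bool :=
  all uniq ss && (b ==> uniq ss).

(** One index tuple for each factor. Different tuples may share indices: these coincidences are what
    the patterns record. *)
Definition families (I : choiceType) (D : set I) (sh : seq nat) (b : bool) :
    set (seq (seq I)) :=
  [set ss | [/\ shape ss = sh, admissible b ss & forall i, i \in flatten ss -> D i]].

(* A family ss of index tuples is determined by the list Y of its distinct
   indices, in order of first occurrence, and by the pattern of the positions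
   in Y of the entries of ss. *)
Definition is_pattern (sh : seq nat) (b : bool) (ps : seq (seq nat)) : bool :=
  [&& shape ps == sh, admissible b ps &
      undup (flatten ps) == iota 0 (size (undup (flatten ps)))].

(** The entries of a pattern are positions among at most [sumn sh] distinct indices, so all patterns
    occur among the maps from ['I_(sumn sh)] to itself. Removing duplicates makes the list usable as
    a finite index set. *)
Definition patterns (sh : seq nat) (b : bool) : seq (seq (seq nat)) :=
  [seq ps <- undup [seq reshape sh [seq val (f a) | a <- enum 'I_(sumn sh)] |
      f : {ffun 'I_(sumn sh) -> 'I_(sumn sh)} <- enum predT] | is_pattern sh b ps].

(** The number of distinct indices in a family with this pattern, hence the order of the factorial
    measure that it contributes. *)
Definition blocks (ps : seq (seq nat)) : nat := size (undup (flatten ps)).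

Definition fill (I : Type) (i0 : I) (Y : seq I) (ps : seq (seq nat)) :=
  [seq [seq nth i0 Y e | e <- p] | p <- ps].

Lemma mem_patterns sh b ps : (ps \in patterns sh b) = is_pattern sh b ps.
Proof.
rewrite mem_filter; case: (boolP (is_pattern sh b ps)) => //= /and3P[/eqP ssh _ /eqP pi].
rewrite mem_undup; set M := sumn sh.
have sM : size (flatten ps) = M by rewrite size_flatten ssh.
have lt_M e : e \in flatten ps -> (e < M)%N.
  rewrite -mem_undup pi mem_iota add0n => /andP[_ /leq_trans]; apply.
  by rewrite -sM size_undup.
apply/mapP; exists [ffun a : 'I_M => insubd a (nth 0%N (flatten ps) a)].
  by rewrite mem_enum.
rewrite -[LHS]flattenK ssh; congr (reshape _ _).
apply: (@eq_from_nth _ 0%N) => [|i]; rewrite sM ?size_map -?enumT ?size_enum_ord// => iM.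
rewrite (nth_map (Ordinal iM)) ?size_enum_ord// ffunE val_insubd nth_enum_ord//.
by rewrite lt_M// mem_nth// sM.
Qed.

Lemma map_inj_in (I J : eqType) (g : I -> J) (A : {pred I}) (s t : seq I) :
  {in A &, injective g} -> {subset s <= A} -> {subset t <= A} ->
  map g s = map g t -> s = t.
Proof.
move=> ginj; elim: s t => [|i s IH] [|j t]//= sA tA [gij gst].
congr (_ :: _); first by apply: ginj => //; [apply: sA|apply: tA]; exact: mem_head.
by apply: IH => // k ks; [apply: sA|apply: tA]; rewrite in_cons ks orbT.
Qed.

Lemma undup_map_in (I J : eqType) (g : I -> J) (s : seq I) :
  {in s &, injective g} -> undup (map g s) = map g (undup s).
Proof.
elim: s => //= i s IH ginj; rewrite IH; last first.
  by move=> j k js ks; apply: ginj; rewrite in_cons ?js ?ks orbT.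
rewrite (_ : (g i \in map g s) = (i \in s)); first by case: ifP.
apply/mapP/idP => [[j js gij]|]; last by exists i.
by rewrite (ginj i j)// in_cons ?eqxx// js orbT.
Qed.

Lemma admissible_map (I J : eqType) (g : I -> J) b (ss : seq (seq I)) :
  {in flatten ss &, injective g} ->
  admissible b (map (map g) ss) = admissible b ss.
Proof.
move=> ginj.
have rowA s : s \in ss -> {subset s <= flatten ss}.
  by move=> sss i i_s; apply/flattenP; exists s.
rewrite /admissible all_map; congr (_ && (_ ==> _)).
  apply: eq_in_all => s sss /=; rewrite map_inj_in_uniq// => i j i_s j_s.
  by apply: ginj; exact: (rowA s sss).
rewrite map_inj_in_uniq// => s t sss tss.
exact: map_inj_in ginj (rowA _ sss) (rowA _ tss).
Qed.

Lemma map_index_uniq (I : eqType) (Y : seq I) :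
  uniq Y -> map (index^~ Y) Y = iota 0 (size Y).
Proof.
move=> uY; case: Y uY => // i0 Y uY.
apply: (@eq_from_nth _ 0%N) => [|a]; rewrite size_map ?size_iota// => aY.
by rewrite (nth_map i0)// nth_iota// index_uniq.
Qed.

Section families.
Context (I : choiceType) (i0 : I).

(** The normalization of patterns makes [Y] recoverable: reading [Y] is injective on the entries of
    [ps], so it commutes with [undup], and it sends the initial segment of the integers to [Y]. *)
Lemma pattern_fill sh b ps (D : set I) (Y : seq I) :
  is_pattern sh b ps -> distinct D (blocks ps) Y ->
  families D sh b (fill i0 Y ps) /\ undup (flatten (fill i0 Y ps)) = Y.
Proof.
move=> /and3P[/eqP psh aps /eqP pi] [sY uY YD].
have lt_Y e : e \in flatten ps -> (e < size Y)%N.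
  by rewrite -mem_undup pi mem_iota add0n sY => /andP[].
have inj : {in flatten ps &, injective (nth i0 Y)}.
  by move=> e f /lt_Y eY /lt_Y fY /eqP; rewrite nth_uniq// => /eqP.
split; last by rewrite /fill -map_flatten undup_map_in// pi -/(blocks ps) -sY map_nth_iota0// take_size.
split; first by rewrite /shape -map_comp -psh; apply: eq_map => p /=; rewrite size_map.
  by rewrite admissible_map.
by move=> i; rewrite -map_flatten => /mapP[e /lt_Y eY ->]; apply: YD; rewrite mem_nth.
Qed.

Lemma families_pattern sh b (D : set I) (ss : seq (seq I)) :
  families D sh b ss ->
  let Y := undup (flatten ss) in let ps := map (map (index^~ Y)) ss in
  [/\ is_pattern sh b ps, distinct D (blocks ps) Y & fill i0 Y ps = ss].
Proof.
move=> [ssh ass sD] Y ps.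
have inj : {in flatten ss &, injective (index^~ Y)}.
  move=> i j iS jS ij; rewrite -(nth_index i0 (s := Y) (x := i)) ?mem_undup//.
  by rewrite ij nth_index// mem_undup.
have ups : undup (flatten ps) = iota 0 (size Y).
  by rewrite /ps -map_flatten undup_map_in// map_index_uniq// undup_uniq.
have bps : blocks ps = size Y by rewrite /blocks ups size_iota.
split.
- apply/and3P; split.
  + by rewrite /shape -map_comp -ssh; apply/eqP/eq_map => p /=; rewrite size_map.
  + by rewrite admissible_map.
  + by rewrite ups size_iota.
- split; [by rewrite bps|exact: undup_uniq|].
  by move=> i; rewrite mem_undup => /sD.
rewrite /fill /ps -map_comp -[RHS]map_id; apply/eq_in_map => s sss /=.
rewrite -map_comp -[RHS]map_id; apply/eq_in_map => i i_s /=.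
by rewrite nth_index// mem_undup; apply/flattenP; exists s.
Qed.

Lemma families_bij sh b (D : set I) :
  set_bij ([set` patterns sh b] `*`` (fun ps => distinct D (blocks ps)))
    (families D sh b) (fun p => fill i0 p.2 p.1).
Proof.
split.
- move=> [ps Y] [/=]; rewrite mem_patterns => pps dY.
  by have [] := pattern_fill pps dY.
- move=> [ps Y] [ps' Y']; rewrite !inE => -[/=]; rewrite mem_patterns => pps dY.
  move=> -[/=]; rewrite mem_patterns => pps' dY' E.
  have [_ YE] := pattern_fill pps dY; have [_ YE'] := pattern_fill pps' dY'.
  have YY' : Y = Y' by rewrite -YE -YE' E.
  congr (_, _) => //.
  have rec ps0 : is_pattern sh b ps0 -> distinct D (blocks ps0) Y ->
      map (map (index^~ Y)) (fill i0 Y ps0) = ps0.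
    move=> /and3P[_ _ /eqP pi] [sY uY _].
    rewrite /fill -map_comp -[RHS]map_id; apply/eq_in_map => p pp /=.
    rewrite -map_comp -[RHS]map_id; apply/eq_in_map => e ep /=.
    rewrite index_uniq//; suff : e \in undup (flatten ps0).
      by rewrite pi mem_iota add0n sY => /andP[].
    by rewrite mem_undup; apply/flattenP; exists p.
  by rewrite -(rec ps)// E -YY' rec// YY'.
- move=> ss fss; have [pps dY fE] := families_pattern fss.
  exists (map (map (index^~ (undup (flatten ss)))) ss, undup (flatten ss)) => //.
  by split => //=; rewrite mem_patterns.
Qed.

Lemma esum_families (R : realType) sh b (D : set I) (H : seq (seq I) -> \bar R) :
  (forall ss, 0 <= H ss) ->
  \esum_(ss in families D sh b) H ss =
  \sum_(ps <- patterns sh b) \esum_(Y in distinct D (blocks ps)) H (fill i0 Y ps).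
Proof.
move=> H0; rewrite (reindex_esum _ _ _ _ (families_bij sh b D)).
rewrite -(esum_esum (a := fun ps Y => H (fill i0 Y ps)))//.
rewrite esum_fset; [|exact: finite_seq|by move=> ps _; exact: esum_ge0].
by rewrite -fsbig_seq /= ?filter_uniq ?undup_uniq.
Qed.

End families.

Lemma measurable_nth_tuple (dT : measure_display) (T : measurableType dT)
    (t0 : T) (j e : nat) :
  measurable_fun [set: j.-tuple T] (fun y : j.-tuple T => nth t0 y e).
Proof.
have [ej|je] := ltnP e j.
  rewrite (_ : (fun y => _) = (@tnth j T)^~ (Ordinal ej)).
    exact: measurable_tnth.
  by apply/funext => y; rewrite (tnth_nth t0).
rewrite (_ : (fun y => _) = cst t0); first exact: measurable_cst.
by apply/funext => y; rewrite nth_default// size_tuple.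
Qed.

Lemma measurable_tup_nth (dT : measure_display) (T : measurableType dT)
    (t0 : T) (j m : nat) (p : seq nat) :
  measurable_fun [set: j.-tuple T]
    (fun y : j.-tuple T => tup t0 m [seq nth t0 y e | e <- p]).
Proof.
apply/measurable_fun_tnthP => i.
rewrite (_ : _ \o _ = fun y : j.-tuple T => if (i < size p)%N then
    nth t0 y (nth 0%N p i) else t0); last first.
  apply/funext => y /=; rewrite tnth_mktuple; case: ltnP => ip.
    by rewrite (nth_map 0%N).
  by rewrite nth_default// size_map.
by case: ltnP => ip; [exact: measurable_nth_tuple|exact: measurable_cst].
Qed.

Lemma families_cons (I : choiceType) (D : set I) m sh :
  set_bij (distinct D m `*`` (fun=> families D sh false))
    (families D (m :: sh) false) (fun p => p.1 :: p.2).
Proof.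
split.
- move=> [s ss] [/= [sm us sD] [ssh]].
  rewrite /admissible andbT => ass ssD; split => //=.
  + by rewrite sm ssh.
  + by rewrite /admissible /= us ass.
  + by move=> i; rewrite mem_cat => /orP[/sD|/ssD].
- by move=> [s ss] [t tt] _ _ /= [-> ->].
- move=> [|s ss] [//= [sm ssh]]; rewrite /admissible /= andbT => /andP[us ass] sD.
  exists (s, ss) => //; split => /=.
    by split => // i i_s; apply: sD; rewrite mem_cat i_s.
  split => //; first by rewrite /admissible andbT.
  by move=> i i_s; apply: sD; rewrite mem_cat i_s orbT.
Qed.

(** Distributivity for non-negative sums. With the flag [false], the tuples of a family are chosen
    freely, one for each factor. *)
Lemma prod_esum_distinct (R : realType) (I : choiceType) (D : set I)
    (K : Type) (r : seq K) (m : K -> nat) (phi : K -> seq I -> \bar R) :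
  (forall i s, 0 <= phi i s) ->
  \prod_(i <- r) (\esum_(s in distinct D (m i)) phi i s) =
  \esum_(ss in families D (map m r) false) (\prod_(q <- zip r ss) phi q.1 q.2).
Proof.
move=> phi0.
have prod0 r' (ss : seq (seq I)) : 0 <= \prod_(q <- zip r' ss) phi q.1 q.2.
  by apply: prode_ge0 => q _.
elim: r => [|i r IH] /=.
  rewrite big_nil (_ : families D [::] false = [set [::]]).
    by rewrite esum_set1 ?big_nil.
  by apply/seteqP; split => [[|s ss] []|_ ->].
rewrite big_cons IH mule_esuml//; last exact: esum_ge0.
rewrite (reindex_esum _ _ _ _ (families_cons D (m i) (map m r))).
rewrite -(esum_esum (a := fun s ss => \prod_(q <- zip (i :: r) (s :: ss)) phi q.1 q.2))//.
apply: eq_esum => s _; rewrite mule_esumr//.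
by apply: eq_esum => ss _; rewrite /= big_cons.
Qed.

Lemma families_setI (I : choiceType) (D E : set I) sh b :
  families (D `&` E) sh b =
  families D sh b `&` [set ss | forall i, i \in flatten ss -> E i].
Proof.
apply/seteqP; split => [ss [ssh ass ssDE]|ss [[ssh ass ssD] ssE]].
  by split; [split => // i /ssDE[]|move=> i /ssDE[]].
by split => // i iss; split; [exact: ssD|exact: ssE].
Qed.

Section families_moments.
Context (R : realType) (d : nat).
Local Notation T := (d.-tuple R).
Local Notation t0 := (nseq_tuple d (0%R : R)).
Context (d1 d2 : measure_display)
  (Om1 : measurableType d1) (Om2 : measurableType d2)
  (P1 : probability Om1 R) (P2 : probability Om2 R)
  (Phi1 : pointProcess d P1) (Phi2 : pointProcess d P2).
Variables (sh : seq nat) (b : bool) (H : seq (seq T) -> \bar R).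
Hypothesis H0 : forall ss, 0 <= H ss.
Hypothesis mH : forall ps,
  measurable_fun setT (fun y : (blocks ps).-tuple T => H (fill t0 y ps)).

(** For a fixed pattern, only the list of distinct indices varies, and a sum over such lists is an
    integral against a factorial measure. *)
Lemma esum_families_factorial (I : choiceType) (D : set I) (i0 : I)
    (x : I -> T) (mu : set T -> \bar R) :
  (forall A, measurable A -> mu A = \esum_(i in D) \d_(x i) A) ->
  \esum_(ss in families D sh b) H (map (map x) ss) =
  \sum_(ps <- patterns sh b)
    \int[factorial_measure (k := blocks ps) mu]_y H (fill t0 y ps).
Proof.
move=> muE; rewrite (esum_families i0 _ _ _ (fun ss => H0 (map (map x) ss))).
rewrite big_seq [RHS]big_seq; apply: eq_bigr => ps; rewrite mem_patterns => pps.
rewrite (integral_dirac_sum _ (factorial_measureE t0 measurable_tuple_point muE))//.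
  apply: eq_esum => Y [sY uY _]; congr H.
  rewrite /fill -map_comp; apply/eq_in_map => p pps' /=.
  rewrite -map_comp; apply/eq_in_map => e ep /=.
  rewrite val_tup ?size_map// (nth_map i0)//.
  have : e \in undup (flatten ps).
    by rewrite mem_undup; apply/flattenP; exists p.
  by case/and3P: pps => _ _ /eqP ->; rewrite mem_iota add0n sY => /andP[].
by move=> X; apply: measurable_tuple1; exact: measurable_tuple_point.
Qed.

(** The common engine of both claims of Part 1, which differ only in the choice of [sh], [b] and
    [H]. *)
Lemma le_integral_families (F1 : Om1 -> \bar R) (F2 : Om2 -> \bar R) :
  (0 < sumn sh)%N ->
  (forall w D (x : nat * nat -> T),
    (forall A, measurable A -> Phi1 w A = \esum_(i in D) \d_(x i) A) ->
    F1 w = \esum_(ss in families D sh b) H (map (map x) ss)) ->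
  (forall w D (x : nat * nat -> T),
    (forall A, measurable A -> Phi2 w A = \esum_(i in D) \d_(x i) A) ->
    F2 w = \esum_(ss in families D sh b) H (map (map x) ss)) ->
  (forall j : nat, (1 <= j <= sumn sh)%N ->
     forall A : set (j.-tuple T), measurable A ->
       factorial_moment P1 (fun w => Phi1 w) A
       <= factorial_moment P2 (fun w => Phi2 w) A) ->
  \int[P1]_w F1 w <= \int[P2]_w F2 w.
Proof.
move=> sh0 F1E F2E le12.
pose S dO (Om : measurableType dO) (P : probability Om R) (Phi : pointProcess d P) w :=
  \sum_(ps <- patterns sh b)
    \int[factorial_measure (k := blocks ps) (Phi w)]_y H (fill t0 y ps).
have -> : F1 = S _ _ _ Phi1.
  apply/funext => w; have [D [x xE]] := pp_atoms Phi1 w.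
  by rewrite (F1E w D x xE) (esum_families_factorial (0%N, 0%N) xE).
have -> : F2 = S _ _ _ Phi2.
  apply/funext => w; have [D [x xE]] := pp_atoms Phi2 w.
  by rewrite (F2E w D x xE) (esum_families_factorial (0%N, 0%N) xE).
rewrite /S !ge0_integral_sum//.
- rewrite big_seq [leRHS]big_seq; apply: lee_sum => ps; rewrite mem_patterns.
  move=> /and3P[/eqP psh _ _]; apply: le_factorial_integral => //.
  (* A pattern has at most as many distinct indices as entries, and at least one since the total
     order is positive. *)
  apply: le12; have sps : size (flatten ps) = sumn sh by rewrite size_flatten psh.
  rewrite -sps size_undup andbT -has_predT; move: sh0; rewrite -sps.
  case: (flatten ps) => // e s _; apply/hasP; exists e => //.
  by rewrite mem_undup mem_head.
- by move=> ps; exact: measurable_factorial_integral.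
- by move=> ps w _; exact: factorial_integral_ge0.
- by move=> ps; exact: measurable_factorial_integral.
- by move=> ps w _; exact: factorial_integral_ge0.
Qed.

End families_moments.

(** * Products of U-statistics and factorial moments of eta *)

Section part_one.
Context (R : realType) (d : nat).
Local Notation T := (d.-tuple R).
Local Notation t0 := (nseq_tuple d (0%R : R)).
Context (d1 d2 : measure_display)
  (Om1 : measurableType d1) (Om2 : measurableType d2)
  (P1 : probability Om1 R) (P2 : probability Om2 R)
  (Phi1 : pointProcess d P1) (Phi2 : pointProcess d P2).

Lemma le_prod_ustat (W : set T) (mW : measurable W) (k : nat)
    (F : 'I_k -> ukernel R d) : (0 < k)%N ->
  (forall j : nat, (1 <= j <= \sum_(i < k) uorder (F i))%N ->
     forall A : set (j.-tuple T), measurable A ->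
       factorial_moment P1 (fun w => Phi1 w) A
       <= factorial_moment P2 (fun w => Phi2 w) A) ->
  \int[P1]_w (\prod_(i < k) ustat (ufun (F i)) (mrestr (Phi1 w) mW))
  <= \int[P2]_w (\prod_(i < k) ustat (ufun (F i)) (mrestr (Phi2 w) mW)).
Proof.
move=> k0 le12.
pose sh := [seq uorder (F i) | i <- index_enum 'I_k].
have shE : sumn sh = (\sum_(i < k) uorder (F i))%N by rewrite sumnE big_map.
pose phi (i : 'I_k) (s : seq T) := ufun (F i) (tup t0 (uorder (F i)) s).
(* The restriction to [W] becomes an indicator in the integrand, so that the hypothesis on the
   unrestricted processes applies. *)
pose H (ss : seq (seq T)) : \bar R :=
  (\prod_(q <- zip (index_enum 'I_k) ss) phi q.1 q.2 *
   (all (mem W) (flatten ss))%:R)%:E.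
have key (D : set (nat * nat)) (x : nat * nat -> T) (mu : set T -> \bar R) :
    (forall A, measurable A -> mu A = \esum_(i in D) \d_(x i) A) ->
    \prod_(i < k) ustat (ufun (F i)) (mrestr mu mW) =
    \esum_(ss in families D sh false) H (map (map x) ss).
  move=> xE; under eq_bigr => i _.
    rewrite (ustatE t0 measurable_tuple_point (mrestr_dirac_sum mW xE)); last first.
      exact: ufun_ge0.
    over.
  rewrite (@prod_esum_distinct R _ (D `&` x @^-1` W) _ (index_enum 'I_k)
    (fun i => uorder (F i)) (fun i s => (phi i (map x s))%:E)); last first.
    by move=> i s; rewrite lee_fin ufun_ge0.
  rewrite families_setI esum_mkcondr; apply: eq_esum => ss _.
  rewrite /H EFinM; have -> : all (mem W) (flatten (map (map x) ss)) =
      (ss \in [set ss : seq (seq (nat * nat)) |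
        forall i, i \in flatten ss -> (x @^-1` W) i]).
    rewrite -map_flatten all_map; apply/allP/idP => [h|].
      by rewrite inE => i /h /= /set_mem.
    by rewrite inE => h i /h /= /mem_set.
  case: ifPn => _; last by rewrite mule0.
  rewrite mule1 -prodEFin (_ : zip _ [seq _ | s <- ss] =
      [seq (q.1, map x q.2) | q <- zip (index_enum 'I_k) ss]).
    by rewrite big_map.
  by elim: (index_enum _) ss => [|i r IH] [|s ss] //=; rewrite IH.
apply: (le_integral_families (sh := sh) (b := false) (H := H)).
- move=> ss; rewrite lee_fin mulr_ge0// prodr_ge0// => q _.
  exact: ufun_ge0.
- move=> ps; apply/measurable_EFinP; apply: measurable_funM.
    rewrite (_ : (fun y => _) = fun y : (blocks ps).-tuple T =>
        \prod_(q <- zip (index_enum 'I_k) ps)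
          phi q.1 [seq nth t0 y e | e <- q.2])%R.
      apply: measurable_prod => q _.
      apply: (measurableT_comp (f := ufun (F q.1)) (g := fun y : (blocks ps).-tuple T =>
        tup t0 (uorder (F q.1)) [seq nth t0 y e | e <- q.2])).
        exact: ufun_measurable.
      exact: measurable_tup_nth.
    apply/funext => y; rewrite /fill.
    rewrite (_ : zip _ [seq _ | p <- ps] =
      [seq (q.1, [seq nth t0 y e | e <- q.2]) | q <- zip (index_enum 'I_k) ps]).
      by rewrite big_map.
    move: (nth t0 y) => h {y}; by elim: (index_enum _) ps => [|i r IH] [|p ps] //=; rewrite IH.
  apply: (@measurableT_comp _ _ _ _ _ _ (fun c : bool => c%:R : R)) => //.
  rewrite (_ : (fun y => _) = fun y : (blocks ps).-tuple T =>
      all (fun e => nth t0 y e \in W) (flatten ps)); last first.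
    by apply/funext => y; rewrite /fill -map_flatten all_map.
  elim: (flatten ps) => [|e s IH] /=; first exact: measurable_cst.
  apply: measurable_and => //.
  apply: (measurable_fun_bool true); rewrite setTI.
  rewrite (_ : _ @^-1` _ = (fun y : (blocks ps).-tuple T => nth t0 y e) @^-1` W).
    by rewrite -[X in measurable X]setTI; exact: measurable_nth_tuple.
  by apply/seteqP; split => y /= => [/set_mem|/mem_set].
- rewrite shE (bigD1 (Ordinal k0))//= addn_gt0; apply/orP; left.
  exact: uorder_gt0.
- by move=> w D x; exact: key.
- by move=> w D x; exact: key.
- by rewrite shE.
Qed.

(** Eta is thus itself a Dirac sum, indexed by the tuples of distinct indices, and the general
    formula for factorial measures applies to it. *)
Lemma eta_pp_dirac_sum (I : choiceType) (D : set I) (x : I -> T)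
    (mu : set T -> \bar R) (m : nat) (f : m.-tuple T -> R) :
  (forall A, measurable A -> mu A = \esum_(i in D) \d_(x i) A) ->
  forall B : set R, eta_pp f mu B =
    \esum_(s in distinct D m) \d_(f (tup t0 m (map x s))) B.
Proof.
move=> muE B; rewrite /eta_pp (ustatE t0 measurable_tuple_point muE)//.
Qed.

(** A factorial power of eta uses distinct index tuples, which may nevertheless overlap: these are
    the families with flag [true]. *)
Lemma distinct_distinct (I : choiceType) (D : set I) (m k : nat) :
  distinct (distinct D m) k = families D (nseq k m) true.
Proof.
apply/seteqP; split => [ss [ssk uss ssD]|ss [ssh /andP[ass uss] ssD]].
  split.
  - apply: (@eq_from_nth _ 0%N) => [|a]; rewrite size_map ?size_nseq// => ak.
    rewrite nth_nseq -ssk ak (nth_map [::])//.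
    by have [] := ssD _ (mem_nth [::] ak).
  - by rewrite /admissible uss andbT; apply/allP => s /ssD[].
  - by move=> i /flattenP[s /ssD[_ _ sD] /sD].
split => //; first by rewrite -(size_map size) -/(shape ss) ssh size_nseq.
move=> s sss; split; last by move=> i i_s; apply: ssD; apply/flattenP; exists s.
  by have := map_f size sss; rewrite -/(shape ss) ssh => /nseqP[].
exact: (allP ass).
Qed.

Lemma le_factorial_moment_eta (k : nat) (f : ukernel R d) : (0 < k)%N ->
  (forall j : nat, (1 <= j <= k * uorder f)%N ->
     forall A : set (j.-tuple T), measurable A ->
       factorial_moment P1 (fun w => Phi1 w) A
       <= factorial_moment P2 (fun w => Phi2 w) A) ->
  forall C : set (k.-tuple R), measurable C ->
    factorial_moment P1 (fun w => eta_pp (ufun f) (Phi1 w)) C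
    <= factorial_moment P2 (fun w => eta_pp (ufun f) (Phi2 w)) C.
Proof.
move=> k0 le12 C mC; set m := uorder f.
pose g (s : seq T) := ufun f (tup t0 m s).
pose H (ss : seq (seq T)) : \bar R := \d_(tup 0%R k (map g ss)) C.
have key (D : set (nat * nat)) (x : nat * nat -> T) (mu : set T -> \bar R) :
    (forall A, measurable A -> mu A = \esum_(i in D) \d_(x i) A) ->
    factorial_measure (k := k) (eta_pp (ufun f) mu) C =
    \esum_(ss in families D (nseq k m) true) H (map (map x) ss).
  move=> muE; rewrite (@factorial_measureE R _ R 0%R _
    (fun s => g (map x s)) _ k _ (distinct D m))//.
  - by rewrite distinct_distinct; apply: eq_esum => ss _; rewrite /H -map_comp.
  - by move=> B _; rewrite (eta_pp_dirac_sum _ muE).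
have shE : sumn (nseq k m) = (k * m)%N by rewrite sumn_nseq mulnC.
apply: (le_integral_families (sh := nseq k m) (b := true) (H := H)).
- by move=> ss.
- move=> ps; rewrite /H.
  apply/measurable_EFinP.
  apply: (measurableT_comp (f := \1_C : k.-tuple R -> R)
    (g := fun y : (blocks ps).-tuple T => tup 0%R k (map g (fill t0 y ps)))).
    exact: measurable_indic.
  apply/measurable_fun_tnthP => i.
  rewrite (_ : _ \o _ = fun y : (blocks ps).-tuple T => if (i < size ps)%N then
      g [seq nth t0 y e | e <- nth [::] ps i] else 0%R); last first.
    apply/funext => y /=; rewrite tnth_mktuple /fill -map_comp; case: ltnP => ip.
      by rewrite (nth_map [::]).
    by rewrite nth_default// size_map.
  case: ltnP => ip; last exact: measurable_cst.
  apply: (measurableT_comp (f := ufun f) (g := fun y : (blocks ps).-tuple T =>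
    tup t0 m [seq nth t0 y e | e <- nth [::] ps i])).
    exact: ufun_measurable.
  exact: measurable_tup_nth.
- by rewrite shE muln_gt0 k0; exact: uorder_gt0.
- by move=> w D x; exact: key.
- by move=> w D x; exact: key.
- by rewrite shE.
Qed.

End part_one.

(** * Directionally convex functions *)

Section dcx_theory.
Context (R : realType).
Local Open Scope ring_scope.

Let tp n (v : 'I_n -> R) : n.-tuple R := [tuple v i | i < n].

Let tpE n (x : n.-tuple R) : tp (tnth x) = x.
Proof. by apply: eq_from_tnth => i; rewrite tnth_mktuple. Qed.

Let shift_tp n i e (v : 'I_n -> R) :
  shift_coord i e (tp v) = tp (fun j => v j + if j == i then e else 0).
Proof. by apply: eq_from_tnth => j; rewrite !tnth_mktuple. Qed.

(** The coordinates of [v] are replaced by those of [w] one at a time; [z r] is the stage at which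
    those listed in [r] have been replaced. *)
Lemma le_coordinatewise n (u : ('I_n -> R) -> R) :
  (forall v i e, 0 < e -> u v <= u (fun j => v j + if j == i then e else 0)) ->
  forall v w, (forall i, v i <= w i) -> u v <= u w.
Proof.
move=> uinc v w vw.
pose z (r : seq 'I_n) j := if j \in r then w j else v j.
have -> : w = z (enum 'I_n) by apply/funext => j; rewrite /z mem_enum.
elim: (enum 'I_n) => [|i r IH]; first by rewrite (_ : z [::] = v)//; apply/funext.
apply: (le_trans IH).
have [zi|zi] := eqVneq (z (i :: r)) (z r); first by rewrite zi.
have ir : i \notin r.
  apply: contraNN zi => ir; apply/eqP/funext => j; rewrite /z in_cons.
  by case: eqVneq => // ->; rewrite ir.
have lt_vw : v i < w i.
  rewrite lt_neqAle vw andbT; apply: contraNN zi => /eqP vwi.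
  apply/eqP/funext => j; rewrite /z in_cons; case: eqVneq => //= ->.
  by rewrite (negbTE ir).
rewrite (_ : z (i :: r) = fun j => z r j + if j == i then w i - v i else 0).
  by apply: uinc; rewrite subr_gt0.
apply/funext => j; rewrite /z in_cons; case: eqVneq => [->|]; last by rewrite addr0.
by rewrite (negbTE ir) addrC subrK.
Qed.

(** [le_coordinatewise] is applied twice. Increments of [g] along one coordinate increase with the
    base point; hence so do the increments along any non-negative direction [q], which are then
    compared at [v] and [v + p]. *)
Lemma dcx_directions n (g : n.-tuple R -> R) (v p q : 'I_n -> R) : dcx g ->
  (forall i, 0 <= p i) -> (forall i, 0 <= q i) ->
  g (tp (fun i => v i + p i)) + g (tp (fun i => v i + q i)) <=
  g (tp (fun i => v i + p i + q i)) + g (tp v).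
Proof.
move=> [_ gdcx] p0 q0.
have step1 i e (w : 'I_n -> R) : 0 < e ->
    g (tp (fun j => w j + if j == i then e else 0)) - g (tp w) <=
    g (tp (fun j => w j + q j + if j == i then e else 0)) -
    g (tp (fun j => w j + q j)).
  move=> e0.
  apply: (@le_coordinatewise n (fun w =>
    g (tp (fun j => w j + if j == i then e else 0)) - g (tp w))); last first.
    by move=> j; rewrite lerDl.
  move=> w' i' e' e'0; have := gdcx (tp w') e' e i' i e'0 e0.
  by rewrite /diff_op !shift_tp subr_ge0.
suff : g (tp (fun j => v j + q j)) - g (tp v) <=
    g (tp (fun j => v j + p j + q j)) - g (tp (fun j => v j + p j)) by lra.
apply: (@le_coordinatewise n (fun w =>
    g (tp (fun j => w j + q j)) - g (tp w))); last by move=> j; rewrite lerDl.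
move=> w i e e0; have := step1 i e w e0.
rewrite (_ : (fun j => w j + (if j == i then e else 0) + q j) =
  (fun j => w j + q j + if j == i then e else 0)); first by lra.
by apply/funext => j; rewrite addrAC.
Qed.

(** Let [a], [b], [c] be the values of [U] at [x] and at its two shifts. Since each [U k] is dcx,
    the value at the double shift is at least [b + c - a]; monotonicity of [g], and its convexity
    along the non-negative directions [b - a] and [c - a], conclude. *)
Lemma dcx_comp n p (g : n.-tuple R -> R) (U : 'I_n -> p.-tuple R -> R) :
  idcx g -> (forall k, idcx (U k)) -> dcx (fun y => g (tp (U^~ y))).
Proof.
move=> [ginc gdcx] Uidcx; split.
  apply: (measurableT_comp (f := g) (g := fun y => tp (U^~ y))); first by case: gdcx.
  apply/measurable_fun_tnthP => i.
  rewrite (_ : _ \o _ = U i); last by apply/funext => y /=; rewrite tnth_mktuple.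
  by have [_ []] := Uidcx i.
move=> x e dl i j e0 dl0; rewrite /diff_op.
pose a k := U k x; pose b k := U k (shift_coord i e x).
pose c k := U k (shift_coord j dl x).
have shift_inc i' e' (y : p.-tuple R) : 0 < e' -> forall k,
    tnth y k <= tnth (shift_coord i' e' y) k.
  by move=> e'0 k; rewrite tnth_mktuple lerDl; case: ifP => // _; exact: ltW.
have ab k : 0 <= b k - a k.
  by rewrite subr_ge0; have [Uinc _] := Uidcx k; apply: Uinc; exact: shift_inc.
have ac k : 0 <= c k - a k.
  by rewrite subr_ge0; have [Uinc _] := Uidcx k; apply: Uinc; exact: shift_inc.
have := dcx_directions a gdcx ab ac.
have -> : (fun k => a k + (b k - a k)) = b by apply/funext => k; rewrite addrC subrK.
have -> : (fun k => a k + (c k - a k)) = c by apply/funext => k; rewrite addrC subrK.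
have : g (tp (fun k => a k + (b k - a k) + (c k - a k))) <=
    g (tp (U^~ (shift_coord j dl (shift_coord i e x)))).
  apply: ginc => k; rewrite !tnth_mktuple.
  have [_ [_ Udcx]] := Uidcx k; have := Udcx x e dl i j e0 dl0.
  rewrite /diff_op -/(a k) -/(b k) -/(c k); lra.
rewrite -/a -/b -/c; lra.
Qed.

(** Non-negativity makes the class stable under products, which [label_poly] needs. *)
Definition ge0_idcx n (h : n.-tuple R -> R) : Prop :=
  (forall x, 0 <= h x) /\ idcx h.

Lemma ge0_idcx_cst n (c : R) : 0 <= c -> ge0_idcx (fun _ : n.-tuple R => c).
Proof.
move=> c0; split => //; split => //; split; first exact: measurable_cst.
by move=> *; rewrite /diff_op !subrr.
Qed.

Lemma ge0_idcxD n (h k : n.-tuple R -> R) :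
  ge0_idcx h -> ge0_idcx k -> ge0_idcx (fun x => h x + k x).
Proof.
move=> [h0 [hinc [mh hdcx]]] [k0 [kinc [mk kdcx]]]; split.
  by move=> x; rewrite addr_ge0.
split; first by move=> x y xy; rewrite lerD ?hinc ?kinc.
split; first exact: measurable_funD.
move=> x e dl i j e0 dl0; have := hdcx x e dl i j e0 dl0.
have := kdcx x e dl i j e0 dl0; rewrite /diff_op; lra.
Qed.

Lemma ge0_idcxM n (h k : n.-tuple R -> R) :
  ge0_idcx h -> ge0_idcx k -> ge0_idcx (fun x => h x * k x).
Proof.
move=> [h0 [hinc [mh hdcx]]] [k0 [kinc [mk kdcx]]]; split.
  by move=> x; rewrite mulr_ge0.
split; first by move=> x y xy; rewrite ler_pM ?hinc ?kinc.
split; first exact: measurable_funM.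
move=> x e dl i j e0 dl0; have := hdcx x e dl i j e0 dl0.
have := kdcx x e dl i j e0 dl0; rewrite /diff_op.
have shift_inc i' e' (y : n.-tuple R) : 0 < e' -> forall k,
    tnth y k <= tnth (shift_coord i' e' y) k.
  by move=> e'0 l; rewrite tnth_mktuple lerDl; case: ifP => // _; exact: ltW.
set E := shift_coord j dl (shift_coord i e x).
set B := shift_coord i e x; set C := shift_coord j dl x.
have hB : h x <= h B by apply: hinc; exact: shift_inc.
have hC : h x <= h C by apply: hinc; exact: shift_inc.
have kB : k x <= k B by apply: kinc; exact: shift_inc.
have kC : k x <= k C by apply: kinc; exact: shift_inc.
move=> kE hE.
(* The left side exceeds [h B * k B + h C * k C - h x * k x] by exactly the two cross products of
   increments that are shown non-negative below. *)
have : (h B + h C - h x) * (k B + k C - k x) <= h E * k E.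
  apply: ler_pM; [have := h0 B; lra|have := k0 B; lra|lra|lra].
have := mulr_ge0 (h0 x) (k0 x).
have : 0 <= (h B - h x) * (k C - k x) by rewrite mulr_ge0 ?subr_ge0.
have : 0 <= (h C - h x) * (k B - k x) by rewrite mulr_ge0 ?subr_ge0.
nra.
Qed.

Lemma ge0_idcx_sum n (J : Type) (r : seq J) (h : J -> n.-tuple R -> R) :
  (forall j, ge0_idcx (h j)) -> ge0_idcx (fun x => \sum_(j <- r) h j x).
Proof.
move=> hh; elim: r => [|j r IH].
  by under eq_fun do rewrite big_nil; exact: ge0_idcx_cst.
by under eq_fun do rewrite big_cons; exact: ge0_idcxD.
Qed.

Lemma ge0_idcx_coord n (k : 'I_n) (c : R) :
  ge0_idcx (fun x : n.-tuple R => Num.max (tnth x k - c) 0).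
Proof.
split; first by move=> x; rewrite le_max lexx orbT.
split; first by move=> x y xy; rewrite ge_max !le_max lexx orbT andbT lerD2r xy.
split.
  apply: measurable_maxr => //; apply: measurable_funB => //.
  exact: measurable_tnth.
move=> x e dl i j e0 dl0; rewrite /diff_op !tnth_mktuple.
set e' := if k == i then e else 0; set d' := if k == j then dl else 0.
have e'0 : 0 <= e' by rewrite /e'; case: ifP => // _; exact: ltW.
have d'0 : 0 <= d' by rewrite /d'; case: ifP => // _; exact: ltW.
by clearbody e' d'; rewrite /Num.max; do 4 (case: ltP => ?); lra.
Qed.

Lemma ge0_idcx_label_poly (C : eqType) n (rk : C -> 'I_n) (t : seq C) :
  ge0_idcx (fun x : n.-tuple R => label_poly (fun c => tnth x (rk c)) t).
Proof.
elim: t => [|c t IH] /=; first exact: ge0_idcx_cst.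
by apply: ge0_idcxM => //; exact: ge0_idcx_coord.
Qed.

(* Along the diagonal an idcx function is convex, hence continuous; by
   monotonicity it is then jointly continuous. *)
Lemma idcx_cvg n (g : n.-tuple R -> R) (Y : nat -> n.-tuple R) (y : n.-tuple R) :
  idcx g -> (forall i, tnth (Y l) i @[l --> \oo] --> tnth y i) ->
  g (Y l) @[l --> \oo] --> g y.
Proof.
move=> [ginc gdcx] Yy.
pose phi s := g (tp (fun i => tnth y i + s)).
have phi0 : phi 0 = g y.
  rewrite /phi -[in RHS](tpE y); congr (g (tp _)).
  by apply/funext => i; rewrite addr0.
have phi_inc s t : s <= t -> phi s <= phi t.
  by move=> st; apply: ginc => i; rewrite !tnth_mktuple lerD2l.
have phi_cvx s p q : 0 <= p -> 0 <= q ->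
    phi (s + p) + phi (s + q) <= phi (s + p + q) + phi s.
  move=> p0 q0; have := @dcx_directions n g (fun i => tnth y i + s) (fun=> p) (fun=> q)
    gdcx (fun=> p0) (fun=> q0).
  have E r : (fun i => tnth y i + (s + r)) = (fun i => tnth y i + s + r).
    by apply/funext => i; rewrite addrA.
  rewrite /phi (_ : (fun i => tnth y i + (s + p + q)) =
    fun i => tnth y i + s + p + q) ?E//.
  by apply/funext => i; rewrite !addrA.
apply/cvgrPdist_le => eps eps0.
pose K := phi 1 - phi 0.
have K0 : 0 <= K by rewrite subr_ge0; exact: phi_inc.
(* By convexity, [N] times the increment of [phi] over [1 / N] is at most the increment [K] over 1;
   [N] is taken so that [K <= N * eps]. *)
pose N := (Num.truncn (K / eps)).+1.
have N0 : 0 < N%:R :> R by rewrite ltr0n.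
pose h : R := N%:R^-1.
have h0 : 0 < h by rewrite invr_gt0.
have phik k : k%:R * (phi h - phi 0) <= phi (k%:R * h) - phi 0.
  elim: k => [|k IH]; first by rewrite !mul0r subrr.
  have := phi_cvx 0 (k%:R * h) h (mulr_ge0 (ler0n _ _) (ltW h0)) (ltW h0).
  rewrite !add0r -[k.+1]addn1 natrD !mulrDl !mul1r; lra.
have phih : phi h - phi 0 <= eps.
  have := phik N; rewrite /h divff ?gt_eqF// -/h => phiN.
  have KN : K <= N%:R * eps.
    by rewrite -ler_pdivrMr//; apply/ltW/truncnS_gt.
  by rewrite -(ler_pM2l N0); apply: (le_trans phiN).
(* Convexity at the midpoint 0 of [- h] and [h] bounds the left increment by the right one. *)
have phih' : phi 0 - phi (- h) <= eps.
  by have := phi_cvx (- h) h h (ltW h0) (ltW h0); rewrite addNr add0r; lra.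
have : \forall l \near \oo, forall i, `|tnth y i - tnth (Y l) i| <= h.
  apply: filter_forall => i.
  by have /cvgrPdist_le := Yy i; apply.
apply: filterS => l Yl.
have gl : g (Y l) <= phi h.
  by apply: ginc => i; rewrite tnth_mktuple; have := Yl i; rewrite ler_norml; lra.
have gl' : phi (- h) <= g (Y l).
  by apply: ginc => i; rewrite tnth_mktuple; have := Yl i; rewrite ler_norml; lra.
rewrite -phi0 ler_norml; lra.
Qed.

End dcx_theory.

(** All kernels must become functions of the same counts; the common label of a point is the family
    of its labels for the various kernels. *)
Lemma grid_joint dT (T : measurableType dT) (V : Type) n (m : 'I_n -> nat)
    (u : forall j, (m j).-tuple T -> V) :
  (forall j, grid (u j)) ->
  exists (C : finType) (a : T -> C) (phi : forall j, (m j).-tuple C -> V),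
    (forall c, measurable (a @^-1` [set c])) /\
    forall j X, u j X = phi j (map_tuple a X).
Proof.
move=> gu.
pose C j := projT1 (cid (gu j)).
pose a j : T -> C j := projT1 (cid (projT2 (cid (gu j)))).
pose phi j : (m j).-tuple (C j) -> V :=
  projT1 (cid (projT2 (cid (projT2 (cid (gu j)))))).
have aP j : (forall c, measurable (a j @^-1` [set c])) /\
    forall X, u j X = phi j (map_tuple (a j) X).
  exact: (projT2 (cid (projT2 (cid (projT2 (cid (gu j))))))).
exists {dffun forall j, C j}, (fun t => [ffun j => a j t]),
  (fun j t => phi j (map_tuple (fun c : {dffun forall j, C j} => c j) t)).
split => [c|j X].
  rewrite (_ : _ @^-1` _ = \bigcap_(j in [set: 'I_n]) a j @^-1` [set c j]).
    by apply: fin_bigcap_measurable => // j _; exact: (aP j).1.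
  apply/seteqP; split => [t <- j _ /=|t tc]; first by rewrite ffunE.
  by apply/ffunP => j; rewrite ffunE; exact: tc.
rewrite (aP j).2; congr (phi j _); apply: eq_from_tnth => i.
by rewrite !tnth_map ffunE.
Qed.

(** * Comparison for grid kernels *)

Section grid_comparison.
Context (R : realType) (d : nat).
Local Notation T := (d.-tuple R).
Local Notation t0 := (nseq_tuple d (0%R : R)).
Variables (n : nat) (m : 'I_n -> nat) (u : forall j, (m j).-tuple T -> R).
Arguments u : clear implicits.
Hypothesis gu : forall j, grid (u j).
Hypothesis u0 : forall j X, (0 <= u j X)%R.
Variables (W : set T) (mW : measurable W).
Hypothesis bW : tbounded W.
Variable g : n.-tuple R -> R.
Hypothesis gidcx : idcx g.

(** The sets [B] and the function [G] do not depend on the process, so a single dcx function tests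
    both processes. *)
Lemma ustats_grid_counts : exists (p : nat) (B : 'I_p -> set T) (G : p.-tuple R -> R),
  [/\ (0 < p)%N, forall i, bounded_borel (B i), dcx G &
    forall dO (Om : measurableType dO) (P : probability Om R)
      (Phi : pointProcess d P) w,
      g (ustats u (mrestr (Phi w) mW)) = G (counts B (Phi w))].
Proof.
have [C [a [phi [ma uE]]]] := grid_joint gu.
pose B (i : 'I_#|C|) := a @^-1` [set enum_val i] `&` W.
have mB i : measurable (B i) by exact: measurableI.
(* The coefficients of the label polynomials must be non-negative on all label tuples, realized or
   not, for [U j] to be idcx. *)
pose phi' j t := Num.max (phi j t) 0%R.
have phi'0 j t : (0 <= phi' j t)%R by rewrite le_max lexx orbT.
pose U j (y : #|C|.-tuple R) := (\sum_(t : (m j).-tuple C)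
  phi' j t * label_poly (fun c => tnth y (enum_rank c)) t)%R.
exists #|C|, B, (fun y => g [tuple U j y | j < n]); split.
- by apply/card_gt0P; exists (a t0).
- by move=> i; apply: bounded_borel_sub (bW) _ _ => // t [].
- apply: dcx_comp => // j; suff [] : ge0_idcx (U j) by [].
  apply: ge0_idcx_sum => t; apply: ge0_idcxM; first exact: ge0_idcx_cst.
  exact: ge0_idcx_label_poly.
move=> dO Om P Phi w; congr g; apply: eq_from_tnth => j; rewrite !tnth_mktuple.
have -> : u j = fun X => phi' j (map_tuple a X).
  by apply/funext => X; rewrite /phi' -uE max_l.
rewrite (ustat_restr_grid Phi mW bW w ma (phi'0 j))/=.
rewrite /U; apply: eq_bigr => t _; congr (_ * label_poly _ _)%R.
by apply/funext => c; rewrite /counts tnth_mktuple /B enum_rankK.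
Qed.

Lemma measurable_ustats_grid dO (Om : measurableType dO) (P : probability Om R)
    (Phi : pointProcess d P) :
  measurable_fun setT (fun w => g (ustats u (mrestr (Phi w) mW))).
Proof.
have [p [B [G [_ bB [mG _] gE]]]] := ustats_grid_counts.
rewrite (funext (gE _ _ _ Phi)).
apply: (measurableT_comp (f := G) (g := fun w => counts B (Phi w))) => //.
apply/measurable_fun_tnthP => i.
rewrite (_ : _ \o _ = fun w => fine (Phi w (B i))).
  by apply: measurable_pp_fine; have [] := bB i.
by apply/funext => w; rewrite /= tnth_mktuple.
Qed.

Lemma le_ustats_grid (d1 d2 : measure_display)
    (Om1 : measurableType d1) (Om2 : measurableType d2)
    (P1 : probability Om1 R) (P2 : probability Om2 R)
    (Phi1 : pointProcess d P1) (Phi2 : pointProcess d P2) :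
  dcx_pp Phi1 Phi2 ->
  P1.-integrable setT (fun w => (g (ustats u (mrestr (Phi1 w) mW)))%:E) ->
  P2.-integrable setT (fun w => (g (ustats u (mrestr (Phi2 w) mW)))%:E) ->
  \int[P1]_w (g (ustats u (mrestr (Phi1 w) mW)))%:E <=
  \int[P2]_w (g (ustats u (mrestr (Phi2 w) mW)))%:E.
Proof.
move=> le12; have [p [B [G [p0 bB dcxG gE]]]] := ustats_grid_counts.
rewrite (funext (fun w => congr1 EFin (gE _ _ _ Phi1 w))).
rewrite (funext (fun w => congr1 EFin (gE _ _ _ Phi2 w))).
by move=> i1 i2; have := le12 p B p0 bB G dcxG i1 i2; rewrite unlock.
Qed.

End grid_comparison.

(** * Approximation of kernels by grid functions *)

Lemma dirac_esum_ge1 (R : realType) d (T : measurableType d) (J : choiceType)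
    (S : set J) (y : J -> T) (A : set T) :
  dirac_esum R S y A != 0 -> 1 <= dirac_esum R S y A.
Proof.
move=> A0; have [[j [Sj Aj]]|h] := pselect (exists j, S j /\ A (y j)).
  apply: le_trans (_ : \d_(y j) A <= _); first by rewrite diracE mem_set.
  exact: (@esum_ge1 _ _ S (fun j => \d_(y j) A)).
case/eqP: A0; rewrite /dirac_esum esum1// => j Sj.
by rewrite diracE memNset// => Aj; apply: h; exists j.
Qed.

Lemma dirac_esum_eq0 (R : realType) d (T : measurableType d) (J : choiceType)
    (S : set J) (y : J -> T) (A : set T) j :
  dirac_esum R S y A = 0 -> S j -> ~ A (y j).
Proof.
move=> A0 Sj Aj; have : \d_(y j) A <= dirac_esum R S y A.
  exact: (@esum_ge1 _ _ S (fun j => \d_(y j) A)).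
by rewrite A0 diracE mem_set// leNgt lte_fin ltr01.
Qed.

Section approximation.
Context (R : realType) (d : nat) (m : nat).
Local Notation T := (d.-tuple R).
Local Notation t0 := (nseq_tuple d (0%R : R)).
Variables (W : set T) (mW : measurable W).
Hypothesis bW : tbounded W.

Section charged.
Context (dO : measure_display) (Om : measurableType dO) (P : probability Om R).
Variable Phi : pointProcess d P.

(** Factorial measures being Dirac sums, this is the event that some tuple of points with distinct
    indices in [W] falls in [A]. *)
Definition charged (A : set (m.-tuple T)) : set Om :=
  [set w | factorial_measure (mrestr (Phi w) mW) A != 0].

Lemma measurable_charged A : measurable A -> measurable (charged A).
Proof.
move=> mA; rewrite (_ : charged A =
  setT `&` (fun w => factorial_measure (mrestr (Phi w) mW) A) @^-1` (~` [set 0])).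
  by apply: measurable_factorial_restr => //; exact: measurableC.
by rewrite setTI; apply/seteqP; split => w /= /eqP.
Qed.

Let fmE w : exists (J : set (seq nat)) (y : seq nat -> m.-tuple T), forall A,
  measurable A ->
  factorial_measure (mrestr (Phi w) mW) A = dirac_esum R J y A.
Proof.
have [n [x [xW xE]]] := pp_restr_dirac Phi mW bW w.
exists (distinct `I_n m), (fun s => tup t0 m (map x s)) => A mA.
by rewrite (factorial_measureE t0 measurable_tuple_point xE).
Qed.

Lemma charged_sub A B : measurable A -> measurable B -> A `<=` B ->
  charged A `<=` charged B.
Proof.
move=> mA mB AB w; rewrite /charged/=; have [J [y yE]] := fmE w; rewrite !yE//.
apply: contraNN => /eqP B0; apply/eqP; exact: subset_measure0 AB B0.
Qed.

Lemma chargedU A B : measurable A -> measurable B ->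
  charged (A `|` B) `<=` charged A `|` charged B.
Proof.
move=> mA mB w; rewrite /charged/=; have [J [y yE]] := fmE w.
rewrite !yE//; last exact: measurableU.
have [A0|A0 _] := eqVneq (dirac_esum R J y A) 0; last by left.
have [B0|B0 _] := eqVneq (dirac_esum R J y B) 0; last by right.
by rewrite (null_set_setU _ _ A0 B0)// eqxx.
Qed.

(** For each realization the mass of [E n] is finite and tends to 0. As it is either 0 or at least
    1, it vanishes eventually: the events decrease to the empty set. *)
Lemma charged_cvg0 (E : nat -> set (m.-tuple T)) :
  (forall n, measurable (E n)) -> (forall n p, (n <= p)%N -> E p `<=` E n) ->
  \bigcap_n E n = set0 -> P (charged (E n)) @[n --> \oo] --> 0.
Proof.
move=> mE ndE E0.
have -> : 0 = P (\bigcap_n charged (E n)).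
  rewrite (_ : \bigcap_n _ = set0) ?measure0//; apply/seteqP; split => // w wE.
  have [J [y yE]] := fmE w.
  have Efin : dirac_esum R J y (E 0%N) < +oo.
    by rewrite -yE// -ge0_fin_numE ?factorial_restr_fin_num// yE.
  have : dirac_esum R J y (E n) @[n --> \oo] --> dirac_esum R J y (\bigcap_n E n).
    apply: nonincreasing_cvg_mu => //; first exact: bigcapT_measurable.
    by move=> n p np; apply/subsetPset; exact: ndE.
  rewrite E0 measure0 => c0.
  have : 1 <= (0 : \bar R).
    apply: (lee_cvg_to (f := cst 1) _ c0); first exact: cvg_cst.
    apply: nearW => n; apply: dirac_esum_ge1; rewrite -yE//; exact: wE.
  by rewrite leNgt lte_fin ltr01.
apply: nonincreasing_cvg_mu => //.
- by rewrite (le_lt_trans (probability_le1 _ _)) ?ltry//; exact: measurable_charged.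
- by move=> n; exact: measurable_charged.
- by apply: bigcapT_measurable => n; exact: measurable_charged.
- by move=> n p np; apply/subsetPset; apply: charged_sub => //; exact: ndE.
Qed.

End charged.

Context (d1 d2 : measure_display)
  (Om1 : measurableType d1) (Om2 : measurableType d2)
  (P1 : probability Om1 R) (P2 : probability Om2 R)
  (Phi1 : pointProcess d P1) (Phi2 : pointProcess d P2).

(* A substitute for a reference measure: the factorial moment measures need not
   be sigma-finite. *)
Definition charge_prob (A : set (m.-tuple T)) : \bar R :=
  P1 (charged Phi1 A) + P2 (charged Phi2 A).

Lemma charge_probU A B : measurable A -> measurable B ->
  charge_prob (A `|` B) <= charge_prob A + charge_prob B.
Proof.
move=> mA mB; have mAB : measurable (A `|` B) by exact: measurableU.
have sub dO (Om : measurableType dO) (P : probability Om R) (Phi : pointProcess d P) :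
    P (charged Phi (A `|` B)) <= P (charged Phi A) + P (charged Phi B).
  apply: (@le_trans _ _ (P (charged Phi A `|` charged Phi B))); last first.
    by apply: measureU2; exact: measurable_charged.
  rewrite le_measure ?inE//; [exact: measurable_charged| |exact: chargedU].
  by apply: measurableU; exact: measurable_charged.
rewrite /charge_prob addeACA; apply: leeD; exact: sub.
Qed.

(** Exact agreement outside a set of small [charge_prob]. The set [B] is a measurable cover, which
    spares proving that the set of disagreement is measurable. *)
Definition approximable (V : eqType) (u : m.-tuple T -> V) : Prop :=
  forall eps : R, (0 < eps)%R -> exists (v : m.-tuple T -> V) (B : set (m.-tuple T)),
    [/\ grid v, measurable B, [set X | u X != v X] `<=` B & charge_prob B <= eps%:E].

Lemma charge_prob0 : charge_prob set0 = 0.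
Proof.
have c0 dO (Om : measurableType dO) (P : probability Om R) (Phi : pointProcess d P) :
    charged Phi set0 = set0.
  apply/seteqP; split => // w; rewrite /charged/=.
  have [n [x [xW xE]]] := pp_restr_dirac Phi mW bW w.
  rewrite (factorial_measureE t0 measurable_tuple_point xE)//.
  by rewrite esum1 ?eqxx// => s _; rewrite dirac0.
by rewrite /charge_prob !c0 !measure0 adde0.
Qed.

Lemma approximable_grid (V : eqType) (u : m.-tuple T -> V) :
  grid u -> approximable u.
Proof.
move=> gu eps eps0; exists u, set0; split => //.
  by move=> X /=; rewrite eqxx.
by rewrite charge_prob0 lee_fin ltW.
Qed.

Lemma approximable_comp2 (V V' V'' : eqType) (h : V -> V' -> V'')
    (u : m.-tuple T -> V) (v : m.-tuple T -> V') :
  approximable u -> approximable v -> approximable (fun X => h (u X) (v X)).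
Proof.
move=> au av eps eps0; have e2 : (0 < eps / 2)%R by rewrite divr_gt0.
have [u' [B [gu' mB uB Be]]] := au _ e2.
have [v' [B' [gv' mB' vB' Be']]] := av _ e2.
exists (fun X => h (u' X) (v' X)), (B `|` B'); split.
- exact: grid_comp2.
- exact: measurableU.
- move=> X /= huv; have [uu'|] := eqVneq (u X) (u' X); last by left; exact: uB.
  have [vv'|] := eqVneq (v X) (v' X); last by right; exact: vB'.
  by rewrite uu' vv' eqxx in huv.
apply: le_trans (charge_probU mB mB') _.
by rewrite [eps]splitr EFinD; exact: leeD.
Qed.

(** The approximable measurable sets form a sigma-algebra containing the grid sets. For a countable
    union, finite unions are approximable and the remainders decrease to the empty set, so
    [charged_cvg0] applies; subadditivity of [charge_prob] replaces additivity. *)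
Lemma approximable_set (A : set (m.-tuple T)) : measurable A ->
  approximable (fun X => X \in A).
Proof.
rewrite measurable_grid_sets.
suff sub : <<s grid_sets (T := T) (m := m) >> `<=`
    [set A | measurable A /\ approximable (fun X => X \in A)] by move=> /sub[].
apply: smallest_sub; last first.
  move=> G gG; split; last exact: approximable_grid.
  by rewrite measurable_grid_sets; exact: sub_gen_smallest.
split.
- split => //; apply: approximable_grid.
  by under eq_fun do rewrite in_set0; exact: grid_cst.
- move=> {}A [mA aA]; rewrite setTD; split; first exact: measurableC.
  under eq_fun do rewrite in_setC.
  exact: (@approximable_comp2 bool bool bool (fun a _ => ~~ a) _ _ aA aA).
- move=> F aF; have mF n : measurable (F n) by have [] := aF n.
  have mUF : measurable (\bigcup_n F n) by exact: bigcupT_measurable.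
  split => // eps eps0; have e2 : (0 < eps / 2)%R by rewrite divr_gt0.
  pose S N := \big[setU/set0]_(k < N) F k.
  have mS N : measurable (S N) by exact: bigsetU_measurable.
  have aS N : approximable (fun X => X \in S N).
    elim: N => [|N IH].
      apply: approximable_grid; rewrite /S big_ord0.
      by under eq_fun do rewrite in_set0; exact: grid_cst.
    rewrite /S big_ord_recr/= -/(S N); under eq_fun do rewrite in_setU.
    by apply: approximable_comp2 => //; exact: (aF N).2.
  pose E N := (\bigcup_n F n) `\` S N.
  have mE N : measurable (E N) by exact: measurableD.
  have ndE n p : (n <= p)%N -> E p `<=` E n.
    move=> np; apply: setDS; rewrite /S -!bigcup_mkord => X [k kn FkX].
    by exists k => //=; exact: leq_trans kn np.
  have E0 : \bigcap_n E n = set0.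
    apply/seteqP; split => // X XE; have [[k _ FkX] _] := XE 0%N Logic.I.
    have [_] := XE k.+1 Logic.I; apply; rewrite /S -bigcup_mkord.
    by exists k => /=.
  have [N EN] : exists N, charge_prob (E N) <= (eps / 2)%:E.
    have : charge_prob (E n) @[n --> \oo] --> 0.
      rewrite -[X in _ --> X](adde0 0); apply: cvgeD => //.
        exact: charged_cvg0.
      exact: charged_cvg0.
    move=> E_cvg; apply: contrapT => /forallNP Ege.
    have : (eps / 2)%:E <= (0 : \bar R).
      apply: (lee_cvg_to (f := cst (eps / 2)%:E) _ E_cvg); first exact: cvg_cst.
      by apply: nearW => n; apply: ltW; rewrite ltNge; apply/negP; exact: Ege.
    by rewrite lee_fin leNgt e2.
  have [v [B [gv mB vB Be]]] := aS N _ e2.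
  exists v, (E N `|` B); split => //; first exact: measurableU.
    move=> X /= Xv; have [XS|XS] := eqVneq (X \in S N) (v X); last by right; exact: vB.
    have SU : S N `<=` \bigcup_n F n.
      by rewrite /S -bigcup_mkord => Z [k _ FkZ]; exists k.
    move: Xv; rewrite -XS; have [XSN|XSN] := boolP (X \in S N).
      by rewrite mem_set//; apply: SU; exact: set_mem.
    case: (boolP (X \in \bigcup_n F n)) => // /set_mem XU _.
    by left; split => //; move/negP: XSN => XSN SX; apply: XSN; exact: mem_set.
  apply: le_trans (charge_probU (mE N) mB) _.
  by rewrite [eps]splitr EFinD; exact: leeD.
Qed.

Import HBNNSimple.

Lemma approximable_nnsfun (s : {nnsfun m.-tuple T >-> R}) : approximable s.
Proof.
have -> : s = (fun X => \sum_(r <- fset_set (range s))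
    (fun b c => (if b then r else 0) + c)%R (X \in s @^-1` [set r]) 0)%R :> (_ -> R).
  apply/funext => X.
  have hX : s X \in fset_set (range s) by rewrite in_fset_set// inE; exists X.
  rewrite (bigD1_seq _ hX (fset_uniq _))/= mem_set//= addr0 big1 ?addr0// => r rX.
  by rewrite memNset ?addr0//= => sX; rewrite sX eqxx in rX.
elim: (fset_set (range s) : seq R) => [|r l IH].
  by under eq_fun do rewrite big_nil; apply: approximable_grid; exact: grid_cst.
under eq_fun do rewrite big_cons addr0.
apply: (@approximable_comp2 bool R R (fun b c => (if b then r else 0) + c)%R) => //.
by apply: approximable_set; exact: measurable_funPTI.
Qed.

(** All finite enumerations of the atoms are allowed, so that later proofs may use whichever one
    they have obtained. *)
Definition atoms_cvg dO (Om : measurableType dO) (P : probability Om R)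
    (Phi : pointProcess d P) (u : nat -> m.-tuple T -> R) (f : m.-tuple T -> R)
    (w : Om) : Prop :=
  forall n (x : nat -> T),
    (forall A, measurable A -> mrestr (Phi w) mW A = \esum_(i in `I_n) \d_(x i) A) ->
    forall s, distinct `I_n m s ->
      u l (tup t0 m (map x s)) @[l --> \oo] --> f (tup t0 m (map x s)).

Lemma grid_approximation (f : m.-tuple T -> R) :
  measurable_fun setT f -> (forall X, 0 <= f X)%R ->
  exists u : nat -> m.-tuple T -> R, [/\ forall l, grid (u l),
    {ae P1, forall w, atoms_cvg Phi1 u f w} & {ae P2, forall w, atoms_cvg Phi2 u f w}].
Proof.
move=> mf f0; have mEf : measurable_fun setT (EFin \o f) by exact/measurable_EFinP.
pose sf l := nnsfun_approx measurableT mEf l.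
(* These bounds add up to 1; any summable sequence would serve Borel-Cantelli. *)
have half0 l : (0 < 1 / (2 ^ l.+1)%:R :> R)%R by rewrite divr_gt0// ltr0n expn_gt0.
have /choice[uB uBP] l : exists uB : (m.-tuple T -> R) * set (m.-tuple T),
    [/\ grid uB.1, measurable uB.2, [set X | sf l X != uB.1 X] `<=` uB.2 &
      charge_prob uB.2 <= (1 / (2 ^ l.+1)%:R)%:E].
  by have [v [B ?]] := @approximable_nnsfun (sf l) _ (half0 l); exists (v, B).
have mB l : measurable (uB l).2 by have [] := uBP l.
exists (fun l => (uB l).1).
have key dO (Om : measurableType dO) (P : probability Om R) (Phi : pointProcess d P) :
    (forall A, measurable A -> P (charged Phi A) <= charge_prob A) ->
    {ae P, forall w, atoms_cvg Phi (fun l => (uB l).1) f w}.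
  move=> leP; pose F l := charged Phi (uB l).2.
  have mF l : measurable (F l) by exact: measurable_charged.
  exists (lim_sup_set F); split.
  - apply: bigcapT_measurable => k; exact: bigcup_measurable.
  - apply: lim_sup_set_cvg0 => //.
    apply: le_lt_trans (_ : 1%:E < +oo); last by rewrite ltry.
    apply: le_trans (epsilon_trick0 xpredT ler01).
    apply: lee_nneseries => l; first by rewrite measure_ge0.
    by move=> _; apply: le_trans (leP _ (mB l)) _; have [] := uBP l.
  - move=> w /= wN k _; apply: contrapT => /forall2NP wF; apply: wN => n x xE s sD.
    (* Beyond rank [k] no tuple of atoms meets the exceptional sets, so there the grid functions
       coincide with the simple functions that converge to [f]. *)
    have FN l : (k <= l)%N -> ~ (uB l).2 (tup t0 m (map x s)).
      move=> kl; have [|/negP] := wF l; first by [].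
      rewrite negbK (factorial_measureE t0 measurable_tuple_point xE)// => /eqP.
      by move=> /(@dirac_esum_eq0 _ _ _ _ _ (fun s => tup t0 m (map x s)) _ s); apply.
    have sf_cvg : sf l (tup t0 m (map x s)) @[l --> \oo] --> f (tup t0 m (map x s)).
      have := cvg_nnsfun_approx measurableT mEf (fun X _ => f0 X)
        (x := tup t0 m (map x s)) Logic.I.
      by move/fine_cvgP => [].
    apply: cvg_trans sf_cvg; apply: near_eq_cvg; near=> l.
    apply/eqP/negPn/negP => sfu; apply: (FN l); first by near: l; exists k.
    by have [_ _ + _] := uBP l; apply; exact: sfu.
split.
- by move=> l; have [] := uBP l.
- by apply: key => A mA; rewrite /charge_prob leeDl.
- by apply: key => A mA; rewrite /charge_prob leeDr.
Unshelve. all: by end_near. Qed.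

End approximation.

(** * Comparison of U-statistics *)

Lemma finite_distinct (I : choiceType) (D : set I) k :
  finite_set D -> finite_set (distinct D k).
Proof.
move=> finD; elim: k => [|k IH].
  by rewrite (_ : distinct D 0 = [set [::]])//; apply/seteqP;
    split => [s [/size0nil ->]|_ ->].
apply: (@sub_finite_set _ _ ((fun p => p.1 :: p.2) @` (D `*` distinct D k))).
  move=> [|i s] [//= [sk] /andP[is_ us] sD]; exists (i, s) => //; split => /=.
    by apply: sD; rewrite mem_head.
  by split => // j js; apply: sD; rewrite in_cons js orbT.
by apply: finite_image; exact: finite_setX.
Qed.

Lemma cvg_big_sum (R : realType) (J : eqType) (r : seq J) (a : nat -> J -> R)
    (b : J -> R) : (forall j, j \in r -> a l j @[l --> \oo] --> b j) ->
  (\sum_(j <- r) a l j)%R @[l --> \oo] --> (\sum_(j <- r) b j)%R.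
Proof.
elim: r => [_|j r IH ab].
  by rewrite big_nil; under eq_fun do rewrite big_nil; exact: cvg_cst.
rewrite big_cons; under eq_fun do rewrite big_cons.
apply: cvgD; first by apply: ab; exact: mem_head.
by apply: IH => k kr; apply: ab; rewrite in_cons kr orbT.
Qed.

(** Clamping does not disturb a limit that already lies between the limits of the two barriers. *)
Lemma cvg_clamp (R : realType) (a b : nat -> R) (f h : R) :
  (0 <= f <= h)%R -> a l @[l --> \oo] --> f -> b l @[l --> \oo] --> h ->
  Num.max 0%R (Num.min (a l) (b l)) @[l --> \oo] --> f.
Proof.
move=> /andP[f0 fh] af bh; apply/cvgrPdist_le => e e0.
have /cvgrPdist_le/(_ e e0) := af; have /cvgrPdist_le/(_ e e0) := bh.
move=> H1 H2; near=> l.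
have : (`|f - a l| <= e)%R by near: l; exact: H2.
have : (`|h - b l| <= e)%R by near: l; exact: H1.
rewrite !ler_norml /Num.max /Num.min.
by case: (ltP (a l) (b l)) => ?; case: ltP => ?; lra.
Unshelve. all: by end_near. Qed.

Section dcx_comparison.
Context (R : realType) (d : nat).
Local Notation T := (d.-tuple R).
Local Notation t0 := (nseq_tuple d (0%R : R)).

Lemma ustat_finite_sum (n m : nat) (x : nat -> T) (mu : set T -> \bar R)
    (f : m.-tuple T -> R) :
  (forall A, measurable A -> mu A = \esum_(i in `I_n) \d_(x i) A) ->
  (forall X, 0 <= f X)%R ->
  ustat f mu = (\sum_(s <- fset_set (distinct `I_n m)) f (tup t0 m (map x s)))%:E.
Proof.
move=> muE f0; rewrite (ustatE t0 measurable_tuple_point muE)//.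
have fin : finite_set (distinct `I_n m) by exact: finite_distinct.
rewrite esum_fset//; last by move=> s _; rewrite lee_fin.
by rewrite fsbig_finite//= sumEFin.
Qed.

(** The partial sums of the series: grid functions below [h], usable as upper barriers without
    leaving the grid class. *)
Lemma rect_sum_partial m (h : m.-tuple T -> R) : rect_sum h ->
  exists hp : nat -> m.-tuple T -> R, [/\ forall l, grid (hp l),
    forall l X, (hp l X <= h X)%R & forall X, hp l X @[l --> \oo] --> h X].
Proof.
move=> [c [B [c0 mB hE]]].
pose q l X := (c l * \prod_(i < m) \1_(B l i) (tnth X i))%R.
have q0 l X : (0 <= q l X)%R.
  by rewrite mulr_ge0// prodr_ge0// => i _; rewrite indicE.
pose hp L X := (\sum_(0 <= l < L) q l X)%R.
exists hp; split.
- move=> L; apply: grid_sum => l; apply: grid_comp2; first exact: grid_cst.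
  apply: grid_prod => i.
  rewrite (_ : (fun X => _) = (fun b : bool => b%:R) \o (fun X => tnth X i \in B l i)).
    by apply: grid_comp; exact: grid_coord.
  by apply/funext => X; rewrite /= indicE.
- move=> L X; rewrite -lee_fin hE -sumEFin; apply: nneseries_lim_ge => l _ _.
  by rewrite lee_fin q0.
- move=> X.
  have : (\sum_(0 <= l < L) (q l X)%:E)%E @[L --> \oo] --> (h X)%:E.
    by rewrite hE; apply: is_cvg_nneseries => l _ _; rewrite lee_fin q0.
  by under eq_fun do rewrite sumEFin; move/fine_cvgP => [].
Qed.

Lemma le_ustats n (m : 'I_n -> nat) (f h : forall j, (m j).-tuple T -> R)
    (mu : set T -> \bar R) (k : nat) (x : nat -> T) :
  (forall A, measurable A -> mu A = \esum_(i in `I_k) \d_(x i) A) ->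
  (forall j X, 0 <= f j X)%R -> (forall j X, 0 <= h j X)%R ->
  (forall j s, distinct `I_k (m j) s ->
     f j (tup t0 (m j) (map x s)) <= h j (tup t0 (m j) (map x s)))%R ->
  forall j, (tnth (ustats f mu) j <= tnth (ustats h mu) j)%R.
Proof.
move=> muE f0 h0 fh j; rewrite !tnth_mktuple !(ustat_finite_sum muE)//=.
rewrite big_seq [leRHS]big_seq; apply: ler_sum => s.
by rewrite in_fset_set ?inE; [exact: fh|exact: finite_distinct].
Qed.

Lemma tup_in (W : set T) k (x : nat -> T) m s :
  (forall i, (i < k)%N -> W (x i)) -> distinct `I_k m s ->
  forall i, W (tnth (tup t0 m (map x s)) i).
Proof.
move=> xW [sm us sk] i; rewrite tnth_mktuple (nth_map 0%N) ?sm//.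
by apply: xW; apply: sk; rewrite mem_nth ?sm.
Qed.

Section comparison.
Variables (W : set T) (mW : measurable W).
Hypothesis bW : tbounded W.
Variables (n : nat) (m : 'I_n -> nat) (f h : forall j, (m j).-tuple T -> R).
Arguments f : clear implicits.
Arguments h : clear implicits.
Hypothesis f0 : forall j X, (0 <= f j X)%R.
Hypothesis h0 : forall j X, (0 <= h j X)%R.
Variable g : n.-tuple R -> R.
Hypothesis gidcx : idcx g.

Lemma idcx_ustats_cvg (v : nat -> forall j, (m j).-tuple T -> R)
    dO (Om : measurableType dO) (P : probability Om R) (Phi : pointProcess d P) :
  (forall l, measurable_fun setT (fun w => g (ustats (v l) (mrestr (Phi w) mW)))) ->
  (forall l j X, 0 <= v l j X)%R ->
  (forall l j X, v l j X <= h j X)%R ->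
  {ae P, forall w, forall j, atoms_cvg mW Phi (fun l => v l j) (f j) w} ->
  measurable_fun setT (fun w => g (ustats f (mrestr (Phi w) mW))) ->
  P.-integrable setT (fun w => (g (ustats h (mrestr (Phi w) mW)))%:E) ->
  [/\ forall l, P.-integrable setT (fun w => (g (ustats (v l) (mrestr (Phi w) mW)))%:E),
   P.-integrable setT (fun w => (g (ustats f (mrestr (Phi w) mW)))%:E) &
   \int[P]_w (g (ustats (v l) (mrestr (Phi w) mW)))%:E @[l --> \oo] -->
   \int[P]_w (g (ustats f (mrestr (Phi w) mW)))%:E].
Proof.
move=> mv v0 vh vf mgf ih.
pose z : n.-tuple R := [tuple 0%R | j < n].
(* As [g] is increasing, [g (ustats (v l) _)] lies between its value at the zero vector and
   [g (ustats h _)], uniformly in [l]. *)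
pose dom w : \bar R := `|g z|%:E + `|(g (ustats h (mrestr (Phi w) mW)))%:E|.
have idom : P.-integrable setT dom.
  apply: integrableD => //; last exact: integrable_abse.
  exact: finite_measure_integrable_cst.
have bound l w : `|(g (ustats (v l) (mrestr (Phi w) mW)))%:E| <= dom w.
  have [k [x [xW xE]]] := pp_restr_dirac Phi mW bW w.
  have lo : (g z <= g (ustats (v l) (mrestr (Phi w) mW)))%R.
    apply: gidcx.1 => j; rewrite !tnth_mktuple fine_ge0// (ustat_finite_sum xE)//.
    by rewrite lee_fin sumr_ge0.
  have hi : (g (ustats (v l) (mrestr (Phi w) mW)) <= g (ustats h (mrestr (Phi w) mW)))%R.
    by apply: gidcx.1 => j; apply: (le_ustats xE).
  rewrite /dom /= -EFinD lee_fin ler_norml.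
  have := ler_norm (- g z)%R; have := ler_norm (g (ustats h (mrestr (Phi w) mW))).
  have := normr_ge0 (g z); have := normr_ge0 (g (ustats h (mrestr (Phi w) mW))).
  rewrite normrN; lra.
have iv l : P.-integrable setT (fun w => (g (ustats (v l) (mrestr (Phi w) mW)))%:E).
  apply: le_integrable idom => //; first exact/measurable_EFinP.
  by move=> w _; rewrite (le_trans (bound l w))// lee_abs.
have cv : {ae P, forall w, setT w ->
    (g (ustats (v l) (mrestr (Phi w) mW)))%:E @[l --> \oo] -->
    (g (ustats f (mrestr (Phi w) mW)))%:E}.
  apply: filterS vf => w vfw _.
  apply: cvg_EFin; first by apply: nearW.
  apply: (idcx_cvg gidcx) => j.
  have [k [x [xW xE]]] := pp_restr_dirac Phi mW bW w.
  rewrite (_ : (fun l => tnth _ j) = (fun l => \sum_(s <- fset_set (distinct `I_k (m j)))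
      v l j (tup t0 (m j) (map x s)))%R); last first.
    by apply/funext => l; rewrite tnth_mktuple (ustat_finite_sum xE).
  rewrite tnth_mktuple (ustat_finite_sum xE)//=.
  apply: cvg_big_sum => s; rewrite in_fset_set ?inE; last exact: finite_distinct.
  exact: vfw xE s.
have bd : {ae P, forall w l, setT w ->
    `|(g (ustats (v l) (mrestr (Phi w) mW)))%:E| <= dom w}.
  by apply: nearW => w l _; exact: bound.
have [igf _ icv] := dominated_convergence measurableT
  (fun l => (measurable_EFinP _ _).2 (mv l)) ((measurable_EFinP _ _).2 mgf) cv idom bd.
by split.
Qed.

End comparison.

Lemma rect_sum_ge0 m (h : m.-tuple T -> R) X : rect_sum h -> (0 <= h X)%R.
Proof.
move=> [c [B [c0 mB hE]]]; rewrite -lee_fin hE; apply: nneseries_ge0 => l _ _.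
by rewrite lee_fin mulr_ge0// prodr_ge0// => i _; rewrite indicE.
Qed.

Lemma restr_atom_in (W : set T) (mW : measurable W) k (x : nat -> T)
    (mu : {measure set T -> \bar R}) :
  (forall A, measurable A -> mrestr mu mW A = \esum_(i in `I_k) \d_(x i) A) ->
  forall i, (i < k)%N -> W (x i).
Proof.
move=> xE i ik; have := xE _ (measurableC mW).
rewrite /mrestr setICl measure0 => /esym W0.
by have /contrapT := dirac_esum_eq0 W0 ik.
Qed.

Section two_processes.
Context (d1 d2 : measure_display)
  (Om1 : measurableType d1) (Om2 : measurableType d2)
  (P1 : probability Om1 R) (P2 : probability Om2 R)
  (Phi1 : pointProcess d P1) (Phi2 : pointProcess d P2).
Hypothesis le12 : dcx_pp Phi1 Phi2.

Lemma le_idcx_ustats (W : set T) (mW : measurable W) (n : nat) (m : 'I_n -> nat)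
    (f : forall j, (m j).-tuple T -> R) (g : n.-tuple R -> R) :
  tbounded W -> (forall j, measurable_fun setT (f j)) ->
  (forall j X, 0 <= f j X)%R -> idcx g ->
  rect_integrable f mW Phi1 Phi2 g ->
  measurable_fun setT (fun w => g (ustats f (mrestr (Phi1 w) mW))) ->
  measurable_fun setT (fun w => g (ustats f (mrestr (Phi2 w) mW))) ->
  [/\ P1.-integrable setT (fun w => (g (ustats f (mrestr (Phi1 w) mW)))%:E),
      P2.-integrable setT (fun w => (g (ustats f (mrestr (Phi2 w) mW)))%:E) &
      \int[P1]_w (g (ustats f (mrestr (Phi1 w) mW)))%:E <=
      \int[P2]_w (g (ustats f (mrestr (Phi2 w) mW)))%:E].
Proof.
move=> bW mf f0 gidcx [h [hrect fh ih1 ih2]] mg1 mg2.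
have h0 j X : (0 <= h j X)%R by exact: rect_sum_ge0.
have uP j := cid (grid_approximation mW bW Phi1 Phi2 (mf j) (f0 j)).
pose u j := sval (uP j).
have gu j l : grid (u j l) by have [+ _ _] := svalP (uP j); apply.
have hpP j := cid (rect_sum_partial (hrect j)).
pose hp j := sval (hpP j).
have ghp j l : grid (hp j l) by have [+ _ _] := svalP (hpP j); apply.
have hp_le j l X : (hp j l X <= h j X)%R by have [_ + _] := svalP (hpP j); apply.
have hp_cvg j X : hp j l X @[l --> \oo] --> h j X.
  by have [_ _ +] := svalP (hpP j); apply.
(* The clamp keeps [v] a grid function below [h]. At tuples of atoms, which lie in [W], one has
   [f <= h], so the limit is still [f]. *)
pose v l j X := Num.max 0%R (Num.min (u j l X) (hp j l X)).
have gv l j : grid (v l j).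
  apply: (@grid_comp _ _ _ _ _ (Num.max (0%R : R))).
  by apply: grid_comp2.
have v0 l j X : (0 <= v l j X)%R by rewrite le_max lexx.
have vh l j X : (v l j X <= h j X)%R.
  by rewrite ge_max h0 ge_min hp_le orbT.
have v_cvg dO (Om : measurableType dO) (P : probability Om R) (Phi : pointProcess d P) w j :
    atoms_cvg mW Phi (u j) (f j) w -> atoms_cvg mW Phi (fun l => v l j) (f j) w.
  move=> uf k x xE s sk; apply: cvg_clamp (uf k x xE s sk) (hp_cvg j _).
  by rewrite f0 fh//; apply: tup_in sk; exact: restr_atom_in xE.
have ae1 : {ae P1, forall w, forall j, atoms_cvg mW Phi1 (fun l => v l j) (f j) w}.
  apply: filter_forall => j; have [_ + _] := svalP (uP j).
  by apply: filterS => w; exact: v_cvg.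
have ae2 : {ae P2, forall w, forall j, atoms_cvg mW Phi2 (fun l => v l j) (f j) w}.
  apply: filter_forall => j; have [_ _ +] := svalP (uP j).
  by apply: filterS => w; exact: v_cvg.
have mv dO (Om : measurableType dO) (P : probability Om R) (Phi : pointProcess d P) l :
    measurable_fun setT (fun w => g (ustats (v l) (mrestr (Phi w) mW))).
  exact: measurable_ustats_grid.
have [iv1 if1 cv1] := idcx_ustats_cvg bW f0 h0 gidcx (mv _ _ _ Phi1) v0 vh ae1 mg1 ih1.
have [iv2 if2 cv2] := idcx_ustats_cvg bW f0 h0 gidcx (mv _ _ _ Phi2) v0 vh ae2 mg2 ih2.
split => //; apply: (lee_cvg_to cv1 cv2); apply: nearW => l.
exact: le_ustats_grid.
Qed.

(** Counts of eta are increasing limits of U-statistics with indicator kernels on growing boxes. On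
    each box [le_idcx_ustats] applies; in the limit [g] at the zero vector and [g] at the full
    counts dominate. *)
Lemma le_idcx_eta (m n : nat) (f : m.-tuple T -> R) (B : 'I_n -> set R)
    (g : n.-tuple R -> R) :
  measurable_fun setT f -> (forall X, 0 <= f X)%R ->
  (forall j, bounded_borel_nneg (B j)) ->
  {ae P1, forall w, locally_finite_nneg (eta_pp f (Phi1 w))} ->
  {ae P2, forall w, locally_finite_nneg (eta_pp f (Phi2 w))} ->
  idcx g ->
  (forall (V : set T) (mV : measurable V), tbounded V ->
     rect_integrable (fun j X => \1_(B j) (f X)) mV Phi1 Phi2 g) ->
  P1.-integrable setT (fun w => (g (eta_counts f B (Phi1 w)))%:E) ->
  P2.-integrable setT (fun w => (g (eta_counts f B (Phi2 w)))%:E) ->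
  \int[P1]_w (g (eta_counts f B (Phi1 w)))%:E <=
  \int[P2]_w (g (eta_counts f B (Phi2 w)))%:E.
Proof.
move=> mf f0 bB lf1 lf2 gidcx rint i1 i2.
pose mV N := (bounded_borel_box R d N).1; pose bV N := (bounded_borel_box R d N).2.
pose ind (j : 'I_n) (X : m.-tuple T) : R := \1_(B j) (f X).
have mfB j : measurable (f @^-1` B j).
  by rewrite -[X in measurable X]setTI; apply: mf => //; have [] := bB j.
have indE j : ind j = \1_(f @^-1` B j).
  by apply/funext => X; rewrite /ind !indicE; congr (_%:R); congr nat_of_bool;
    apply/idP/idP; rewrite !inE.
have mind j : measurable_fun setT (ind j) by rewrite indE; exact: measurable_indic.
have ind0 j X : (0 <= ind j X)%R by rewrite /ind indicE.
(* For indicator kernels the U-statistics are factorial measures of the preimages of the [B j],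
   whose measurability is known. *)
have mg dO (Om : measurableType dO) (P : probability Om R) (Phi : pointProcess d P) N :
    measurable_fun setT (fun w => g (ustats ind (mrestr (Phi w) (mV N)))).
  apply: (measurableT_comp (f := g)
    (g := fun w => ustats ind (mrestr (Phi w) (mV N)))); first by have [_ []] := gidcx.
  apply/measurable_fun_tnthP => j.
  rewrite (_ : _ \o _ = fine \o
      (fun w => factorial_measure (mrestr (Phi w) (mV N)) (f @^-1` B j))).
    apply: (measurableT_comp (fine_measurable _)) => //.
    by apply: measurable_factorial_restr => //; exact: bV.
  apply/funext => w; rewrite /= tnth_mktuple indE; congr fine.
  have [k [x [xW xE]]] := pp_restr_dirac Phi (mV N) (bV N) w.
  by rewrite (factorial_measure_ustat xE).
have cvg_eta dO (Om : measurableType dO) (P : probability Om R)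
    (Phi : pointProcess d P) :
    {ae P, forall w, locally_finite_nneg (eta_pp f (Phi w))} ->
    P.-integrable setT (fun w => (g (eta_counts f B (Phi w)))%:E) ->
    \int[P]_w (g (ustats ind (mrestr (Phi w) (mV N))))%:E @[N --> \oo] -->
    \int[P]_w (g (eta_counts f B (Phi w)))%:E.
  move=> lf ig; pose z : n.-tuple R := [tuple 0%R | j < n].
  pose dom w : \bar R := `|g z|%:E + `|(g (eta_counts f B (Phi w)))%:E|.
  have idom : P.-integrable setT dom.
    apply: integrableD => //; last exact: integrable_abse.
    exact: finite_measure_integrable_cst.
  have main w : locally_finite_nneg (eta_pp f (Phi w)) -> forall j,
      (tnth (ustats ind (mrestr (Phi w) (mV N))) j @[N --> \oo] -->
       tnth (eta_counts f B (Phi w)) j) /\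
      forall N, (0 <= tnth (ustats ind (mrestr (Phi w) (mV N))) j <=
       tnth (eta_counts f B (Phi w)) j)%R.
    move=> lfw j; have [D [x xE]] := pp_atoms Phi w.
    pose S N := distinct (D `&` x @^-1` box N) m.
    have Dnd N M : (N <= M)%N -> D `&` x @^-1` @box R d N `<=` D `&` x @^-1` @box R d M.
      by move=> NM i [Di xi]; split => //; exact: box_nondecreasing xi.
    have SU : distinct D m = \bigcup_N S N.
      rewrite -distinct_bigcup// -setI_bigcupr -preimage_bigcup bigcup_box.
      by rewrite preimage_setT setIT.
    pose a (s : seq (nat * nat)) : \bar R := (ind j (tup t0 m (map x s)))%:E.
    have uE N : ustat (ind j) (mrestr (Phi w) (mV N)) = \esum_(s in S N) a s.
      by rewrite (ustatE t0 measurable_tuple_point (mrestr_dirac_sum (mV N) xE)).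
    have eE : eta_pp f (Phi w) (B j) = \esum_(s in distinct D m) a s.
      by rewrite (eta_pp_dirac_sum _ xE); apply: eq_esum => s _.
    (* [B j] lies in some interval from 0 to [M], to which eta gives finite mass; this makes [fine]
       harmless in the limit. *)
    have efin : \esum_(s in distinct D m) a s < +oo.
      rewrite -eE; have [_ [M BM]] := bB j; apply: le_lt_trans (lfw M).
      rewrite !(eta_pp_dirac_sum _ xE); apply: le_esum => s _.
      rewrite !diracE lee_fin ler_nat.
      by case: (boolP (_ \in B j)) => // /set_mem/BM/mem_set ->.
    have e0 : 0 <= \esum_(s in distinct D m) a s.
      by apply: esum_ge0 => s _; rewrite lee_fin.
    have u0 N : 0 <= \esum_(s in S N) a s by apply: esum_ge0 => s _; rewrite lee_fin.
    have ue N : \esum_(s in S N) a s <= \esum_(s in distinct D m) a s.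
      by apply: esum_subset; rewrite SU => s Ss; exists N.
    split => [|N]; rewrite !tnth_mktuple eE.
      under eq_fun do rewrite tnth_mktuple uE.
      apply: fine_cvg; rewrite fineK ?ge0_fin_numE//.
      rewrite SU; apply: cvg_esum => N M NM s [sm us sD]; split => // i /sD.
      exact: Dnd.
    rewrite uE fine_ge0//= fine_le ?ge0_fin_numE//.
    exact: le_lt_trans (ue N) efin.
  have cv : {ae P, forall w, setT w ->
      (g (ustats ind (mrestr (Phi w) (mV N))))%:E @[N --> \oo] -->
      (g (eta_counts f B (Phi w)))%:E}.
    apply: filterS lf => w lfw _; apply: cvg_EFin; first by apply: nearW.
    by apply: (idcx_cvg gidcx) => j; have [] := main w lfw j.
  have bd : {ae P, forall w N, setT w ->
      `|(g (ustats ind (mrestr (Phi w) (mV N))))%:E| <= dom w}.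
    apply: filterS lf => w lfw N _.
    have lo : (g z <= g (ustats ind (mrestr (Phi w) (mV N))))%R.
      apply: gidcx.1 => j; rewrite tnth_mktuple.
      by have [_ /(_ N)/andP[]] := main w lfw j.
    have hi : (g (ustats ind (mrestr (Phi w) (mV N))) <= g (eta_counts f B (Phi w)))%R.
      by apply: gidcx.1 => j; have [_ /(_ N)/andP[]] := main w lfw j.
    rewrite /dom /= -EFinD lee_fin ler_norml.
    have := ler_norm (- g z)%R; have := ler_norm (g (eta_counts f B (Phi w))).
    have := normr_ge0 (g z); have := normr_ge0 (g (eta_counts f B (Phi w))).
    rewrite normrN; lra.
  by have [_ _] := dominated_convergence measurableT
    (fun N => (measurable_EFinP _ _).2 (mg _ _ _ Phi N)) (measurable_int _ ig) cv idom bd.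
apply: (lee_cvg_to (cvg_eta _ _ _ _ lf1 i1) (cvg_eta _ _ _ _ lf2 i2)).
apply: nearW => N.
by have [] := le_idcx_ustats (bV N) mind ind0 gidcx (rint _ (mV N) (bV N)) (mg _ _ _ Phi1 N) (mg _ _ _ Phi2 N).
Qed.

End two_processes.

End dcx_comparison.

Theorem proposition17 (R : realType) (d : nat) (hd : (0 < d)%N)
  (d1 d2 : measure_display)
  (Om1 : measurableType d1) (Om2 : measurableType d2)
  (P1 : probability Om1 R) (P2 : probability Om2 R)
  (Phi1 : pointProcess d P1) (Phi2 : pointProcess d P2)
  (W : set (d.-tuple R)) (mW : measurable W) (bW : tbounded W)
  (K : set (ukernel R d)) :
  ((forall (k : nat) (F : 'I_k -> ukernel R d), (0 < k)%N ->
      (forall i, K (F i)) ->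
      (forall j : nat, (1 <= j <= \sum_(i < k) uorder (F i))%N ->
         forall A : set (j.-tuple (d.-tuple R)), measurable A ->
           factorial_moment P1 (fun w => Phi1 w) A
           <= factorial_moment P2 (fun w => Phi2 w) A) ->
      \int[P1]_w (\prod_(i < k) ustat (F i) (mrestr (Phi1 w) mW))
      <= \int[P2]_w (\prod_(i < k) ustat (F i) (mrestr (Phi2 w) mW)))
   /\
   (forall (k : nat) (f : ukernel R d), (0 < k)%N ->
      K f -> finite_sublevels f ->
      (forall j : nat, (1 <= j <= k * uorder f)%N ->
         forall A : set (j.-tuple (d.-tuple R)), measurable A ->
           factorial_moment P1 (fun w => Phi1 w) A
           <= factorial_moment P2 (fun w => Phi2 w) A) ->
      forall C : set (k.-tuple R), measurable C ->
        factorial_moment P1 (fun w => eta_pp f (Phi1 w)) C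
        <= factorial_moment P2 (fun w => eta_pp f (Phi2 w)) C))
  /\
  (dcx_pp Phi1 Phi2 ->
   (forall (n : nat) (F : 'I_n -> ukernel R d), (0 < n)%N ->
      (forall j, K (F j)) ->
      le_for P1 P2
        (@idcx R n `&` rect_integrable (fun j => ufun (F j)) mW Phi1 Phi2)
        (fun w => ustats (fun j => ufun (F j)) (mrestr (Phi1 w) mW))
        (fun w => ustats (fun j => ufun (F j)) (mrestr (Phi2 w) mW)))
   /\
   (forall f : ukernel R d, K f -> finite_sublevels f ->
      {ae P1, forall w, locally_finite_nneg (eta_pp f (Phi1 w))} ->
      {ae P2, forall w, locally_finite_nneg (eta_pp f (Phi2 w))} ->
      forall (n : nat) (B : 'I_n -> set R), (0 < n)%N ->
        (forall j, bounded_borel_nneg (B j)) ->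
        le_for P1 P2
          (@idcx R n `&` [set g | forall (V : set (d.-tuple R))
             (mV : measurable V), tbounded V ->
             rect_integrable (fun j X => \1_(B j) (f X)) mV Phi1 Phi2 g])
          (fun w => eta_counts f B (Phi1 w)) (fun w => eta_counts f B (Phi2 w)))).
Proof.
split; [split|move=> le12; split].
- by move=> k F k0 _ le12; exact: le_prod_ustat.
- by move=> k f k0 _ _ le12; exact: le_factorial_moment_eta.
- move=> n F n0 _ g [gidcx rint] i1 i2; rewrite unlock.
  (* The measurability of [g] of the U-statistics is part of their assumed integrability. *)
  have mg dO (Om : measurableType dO) (P : probability Om R) (G : Om -> R) :
      P.-integrable setT (fun w => (G w)%:E) -> measurable_fun setT G.
    by move=> iG; exact: (measurable_EFinP _ _).1 (measurable_int _ iG).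
  have mF j : measurable_fun setT (ufun (F j)) by exact: ufun_measurable.
  have F0 j X : (0 <= ufun (F j) X)%R by exact: ufun_ge0.
  by have [] := le_idcx_ustats le12 bW mF F0 gidcx rint (mg _ _ _ _ i1) (mg _ _ _ _ i2).
- move=> f _ _ lf1 lf2 n B n0 bB g [gidcx rint] i1 i2; rewrite unlock.
  apply: (le_idcx_eta le12 _ _ bB lf1 lf2 gidcx rint i1 i2).
    exact: ufun_measurable.
  exact: ufun_ge0.
Qed.
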